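(* Let $w\in S_n$ be a covexillary permutation. Let $h:\mathfrak g\to Gr(n,2n)$ be the graph embedding $x\mapsto \mathrm{Col}\begin{pmatrix}I(n)\\ x\end{pmatrix}$. Then there exist a permutation $\tau\in S_{2n}$ and a Schubert variety $Gr_{\underline v}\subset Gr(n,2n)$ such that the composite map $$\tau\circ h:\mathfrak g\to Gr(n,2n),\qquad x\mapsto \tau\,\mathrm{Col}\begin{pmatrix}I(n)\\ x\end{pmatrix}$$ induces an open immersion $\mathfrak g_w\hookrightarrow Gr_{\underline v}$.
   Context: Everything is over $\mathbb C$. $\mathfrak g$ is the space of $n\times n$ matrices, and $B\subset GL_n$ is the group of invertible upper triangular matrices. A permutation $w\in S_n$ is identified with the $n\times n$ matrix with $1$s in positions $(w(i),i)$, $1\le i\le n$, and $0$s elsewhere. A permutation $w\in S_n$ is covexillary if it avoids the pattern $3412$, i.e., there are no indices $1\le i<j<k<l\le n$ with $w(k)<w(l)<w(i)<w(j)$. The matrix Schubert variety is $\mathfrak g_w=\overline{BwB}$ (closure in $\mathfrak g$), with its reduced structure. $Gr(n,2n)$ is the Grassmannian of $n$-dimensional subspaces of $\mathbb C^{2n}$; $\mathrm{Col}(A)$ denotes the column span of a matrix $A$; $I(n)$ is the identity matrix; $\tau\in S_{2n}$ acts on $Gr(n,2n)$ by left multiplication by its permutation matrix. Schubert varieties in $Gr(n,2n)$ are the closures of the orbits of the group of invertible upper triangular $2n\times 2n$ matrices. They are indexed by increasing sequences $\underline v=(v_1<\cdots<v_n)$ in $\{1,\dots,2n\}$, with $Gr_{\underline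 v}=\{V: \dim(V+E_{v_i})\le n+v_i-i\ \forall\,1\le i\le n\}$, where $E_k=\langle e_1,\dots,e_k\rangle\subset\mathbb C^{2n}$. ''Induces an open immersion $\mathfrak g_w\hookrightarrow Gr_{\underline v}$'' means that the restriction of the map to $\mathfrak g_w$ takes values in $Gr_{\underline v}$ and is an isomorphism onto an open subvariety of $Gr_{\underline v}$. *)

(* Defs.v *)
From mathcomp Require Import all_boot all_order all_fingroup all_algebra.
From mathcomp Require Import boolp classical_sets reals complex.
From mathcomp Require Import mpoly.

Import Order.TTheory GRing.Theory Num.Theory.
Local Open Scope classical_set_scope.
Local Open Scope ring_scope.

(* Varieties over an algebraically closed field K are treated classically, as
   spaces with functions: a set of points, a topology on it, and for each open
   U the K-valued functions that are regular on U.  The points form a subset of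
   an ambient type, and only the restriction of f to U matters in
   [regular X U f]. *)
Record space (K : fieldType) := Space {
  ambient : Type;
  carrier : set ambient;
  is_open : set ambient -> Prop;
  regular : set ambient -> (ambient -> K) -> Prop }.
Arguments ambient {K} _.
Arguments carrier {K} _ _.
Arguments is_open {K} _ _.
Arguments regular {K} _ _ _.

(* The induced (reduced) structure on a locally closed subset: functions that
   locally extend to regular functions on open subsets of X. *)
Definition subspace {K : fieldType} (X : space K) (A : set (ambient X)) :
    space K := {|
  ambient := ambient X;
  carrier := carrier X `&` A;
  is_open := fun U =>
    exists2 V : set (ambient X), is_open X V & U = V `&` A;
  regular := fun U f => forall x, U x ->
    exists (W : set (ambient X)) (g : ambient X -> K),
      [/\ is_open X W, W x, regular X W g
        & forall y, W y -> U y -> f y = g y] |}.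

Definition space_closure {K : fieldType} (X : space K) (A : set (ambient X)) :
    set (ambient X) :=
  [set x | carrier X x /\
           forall U : set (ambient X), is_open X U -> U x -> U `&` A !=set0].

Definition morphism {K : fieldType} (X Y : space K)
    (f : ambient X -> ambient Y) : Prop :=
  (forall x, carrier X x -> carrier Y (f x)) /\
  (forall V : set (ambient Y), is_open Y V ->
     is_open X (carrier X `&` f @^-1` V) /\
     forall g : ambient Y -> K, regular Y V g ->
       regular X (carrier X `&` f @^-1` V) (g \o f)).

Definition isomorphism {K : fieldType} (X Y : space K)
    (f : ambient X -> ambient Y) : Prop :=
  morphism X Y f /\
  exists g : ambient Y -> ambient X,
    [/\ morphism Y X g,
        forall x, carrier X x -> g (f x) = x
      & forall y, carrier Y y -> f (g y) = y].

Definition open_immersion {K : fieldType} (X Y : space K)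
    (f : ambient X -> ambient Y) : Prop :=
  exists2 U : set (ambient Y), is_open Y U & isomorphism X (subspace Y U) f.

Definition mx_eval {K : fieldType} {m p : nat} (P : {mpoly K[m * p]})
    (M : 'M[K]_(m, p)) : K :=
  P.@[fun k => mxvec M 0 k].

Definition zariski_open {K : fieldType} {m p : nat} (U : set 'M[K]_(m, p)) :
    Prop :=
  exists S : set {mpoly K[m * p]},
    forall M, U M <-> exists2 P, S P & mx_eval P M != 0.

Definition zariski_regular {K : fieldType} {m p : nat} (U : set 'M[K]_(m, p))
    (f : 'M[K]_(m, p) -> K) : Prop :=
  forall M, U M -> exists (W : set 'M[K]_(m, p)) (P Q : {mpoly K[m * p]}),
    [/\ zariski_open W, W M, W `<=` U
      & forall N, W N -> mx_eval Q N != 0 /\ f N = mx_eval P N / mx_eval Q N].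

Definition affine_mx (K : fieldType) (m p : nat) : space K := {|
  ambient := 'M[K]_(m, p);
  carrier := setT;
  is_open := zariski_open;
  regular := zariski_regular |}.

Definition Col {K : fieldType} {m p : nat} (M : 'M[K]_(m, p)) :
    {vspace 'cV[K]_m} :=
  <<[seq col j M | j : 'I_p]>>%VS.

Definition frames {K : fieldType} {m : nat} (k : nat)
    (U : set {vspace 'cV[K]_m}) : set 'M[K]_(m, k) :=
  [set M | \rank M = k /\ U (Col M)].

(* Gr(k, m) with its structure of geometric quotient of the open set of m x k
   matrices of rank k by GL_k, the quotient map being [Col]. *)
Definition Gr (K : fieldType) (k m : nat) : space K := {|
  ambient := {vspace 'cV[K]_m};
  carrier := [set V : {vspace 'cV[K]_m} | \dim V = k];
  is_open := fun U => U `<=` [set V : {vspace 'cV[K]_m} | \dim V = k] /\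
                      zariski_open (frames k U);
  regular := fun U f => zariski_regular (frames k U) (f \o Col) |}.

Definition borel (K : fieldType) (m : nat) : set 'M[K]_m :=
  [set b | b \in unitmx /\ forall i j : 'I_m, (j < i)%N -> b i j = 0].

(* mathcomp's [perm_mx w] has its 1s in positions (i, w i) instead. *)
Definition perm_matrix (K : fieldType) {m : nat} (w : 'S_m) : 'M[K]_m :=
  \matrix_(i, j) (i == w j)%:R.

Definition covexillary {n : nat} (w : 'S_n) : Prop :=
  ~ exists i j k l : 'I_n,
      [/\ (i < j)%N, (j < k)%N & (k < l)%N] /\
      [/\ (w k < w l)%N, (w l < w i)%N & (w i < w j)%N].

Definition matrix_schubert (K : fieldType) {n : nat} (w : 'S_n) :
    set 'M[K]_n :=
  space_closure (affine_mx K n n)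
    [set x | exists b c : 'M[K]_n,
       [/\ borel K n b, borel K n c & x = b *m perm_matrix K w *m c]].

Definition mx_act {K : fieldType} {m : nat} (g : 'M[K]_m)
    (V : {vspace 'cV[K]_m}) : {vspace 'cV[K]_m} :=
  (linfun (mulmx g) @: V)%VS.

Definition is_schubert_variety {K : fieldType} (k m : nat)
    (Z : set {vspace 'cV[K]_m}) : Prop :=
  exists2 V : {vspace 'cV[K]_m}, \dim V = k &
    Z = space_closure (Gr K k m) [set mx_act b V | b in borel K m].

Definition flag_space (K : fieldType) (m k : nat) : {vspace 'cV[K]_m} :=
  <<[seq delta_mx i ord0 | i : 'I_m <- enum 'I_m & (i < k)%N]>>%VS.

(* Indices are 0-based: the usual i and v_i are i.+1 and (v i).+1, and i is
   moved to the left-hand side to avoid truncated subtraction. *)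
Definition Gr_schubert (K : fieldType) {k m : nat} (v : 'I_k -> 'I_m) :
    set {vspace 'cV[K]_m} :=
  [set V : {vspace 'cV[K]_m} | \dim V = k /\
     forall i : 'I_k,
       (\dim (V + flag_space K m (v i).+1)%VS + i.+1 <= k + (v i).+1)%N].

Definition graph_embedding {K : fieldType} {n : nat} (x : 'M[K]_n) :
    {vspace 'cV[K]_(n + n)} :=
  Col (col_mx 1%:M x).

(* Main.v *)
Require Import Defs.
From mathcomp Require Import all_boot all_order all_fingroup all_algebra.
From mathcomp Require Import boolp classical_sets reals complex.
From mathcomp Require Import mpoly.
From mathcomp Require Import zify.
Import Defs.

(* Write r_x(p, q) for the rank of the south-west block of x formed by the rows
   from p on and the columns before q.  On BwB one has r_x = r_w, so r_x <= r_w
   on its closure.  Conversely, by Fulton's argument these inequalities all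
   follow from those at the positions (p, q) of the essential set of w, and w
   being covexillary means that the essential set is a chain (p and q increase
   together).  The condition at (p, q) bounds the dimension of V + E_S, where V
   is the graph of x and S consists of the first q coordinates of the source and
   the first p of the target; these S form a chain, so a permutation tau turns
   them into initial segments, and the conditions into those of a Schubert
   variety Gr_v.

   It remains to see that the conditions define closures of orbits.  A space V
   in Gr_v has a basis f_1, ..., f_n with f_i in E_(v_i).  Moving such adapted
   frames along lines shows that Gr_v is the closure of a Borel orbit, and that
   any two points x, y of its preimage under the chart are joined by a rational
   curve inside this preimage.  With y = w, a general point z of the curve has
   r_z = r_w, hence lies in BwB. *)

Set Implicit Arguments.
Unset Strict Implicit.
Unset Printing Implicit Defensive.

Import Order.TTheory GRing.Theory Num.Theory.
Local Open Scope classical_set_scope.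
Local Open Scope ring_scope.

(** * Polynomial and rational functions on matrices *)

(** Stated for an arbitrary class of functions, so that closure under determinants, adjugates and
    polynomial evaluation is proved once and serves polynomial functions, fractions and univariate
    polynomials alike. *)
Definition fun_subring (K : comNzRingType) (T : Type) (A : (T -> K) -> Prop) :=
  [/\ forall c, A (fun=> c),
      forall f g, A f -> A g -> A (fun x => f x + g x)
    & forall f g, A f -> A g -> A (fun x => f x * g x)].

Lemma fun_subring_sum (K : comNzRingType) (T : Type) (A : (T -> K) -> Prop)
    (I : Type) (r : seq I) (P : pred I) (F : I -> T -> K) :
  fun_subring A -> (forall i, A (F i)) ->
  A (fun x => \sum_(i <- r | P i) F i x).
Proof.
move=> [Ac Ad _] AF; elim: r => [|i r IHr].
  by rewrite (_ : (fun _ => _) = fun=> 0)//; apply/funext => x; rewrite big_nil.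
case Pi: (P i).
  rewrite (_ : (fun _ => _) = fun x => F i x + \sum_(j <- r | P j) F j x).
    exact: Ad.
  by apply/funext => x; rewrite big_cons Pi.
rewrite (_ : (fun _ => _) = fun x => \sum_(j <- r | P j) F j x)//.
by apply/funext => x; rewrite big_cons Pi.
Qed.

Lemma fun_subring_prod (K : comNzRingType) (T : Type) (A : (T -> K) -> Prop)
    (I : Type) (r : seq I) (P : pred I) (F : I -> T -> K) :
  fun_subring A -> (forall i, A (F i)) ->
  A (fun x => \prod_(i <- r | P i) F i x).
Proof.
move=> [Ac _ Am] AF; elim: r => [|i r IHr].
  by rewrite (_ : (fun _ => _) = fun=> 1)//; apply/funext => x; rewrite big_nil.
case Pi: (P i).
  rewrite (_ : (fun _ => _) = fun x => F i x * \prod_(j <- r | P j) F j x).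
    exact: Am.
  by apply/funext => x; rewrite big_cons Pi.
rewrite (_ : (fun _ => _) = fun x => \prod_(j <- r | P j) F j x)//.
by apply/funext => x; rewrite big_cons Pi.
Qed.

Lemma fun_subringX (K : comNzRingType) (T : Type) (A : (T -> K) -> Prop)
    (f : T -> K) (d : nat) :
  fun_subring A -> A f -> A (fun x => f x ^+ d).
Proof.
move=> sA Af; rewrite (_ : (fun _ => _) = fun x => \prod_(i < d) f x).
  exact: fun_subring_prod.
by apply/funext => x; rewrite prodr_const card_ord.
Qed.

Lemma fun_subring_meval (K : comNzRingType) (T : Type) (A : (T -> K) -> Prop)
    (n : nat) (P : {mpoly K[n]}) (v : T -> 'I_n -> K) :
  fun_subring A -> (forall k, A (fun x => v x k)) ->
  A (fun x => P.@[v x]).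
Proof.
move=> sA Av; have [Ac _ Am] := sA.
rewrite (_ : (fun _ => _) =
  fun x => \sum_(m <- msupp P) P@_m * \prod_i v x i ^+ m i); last first.
  by apply/funext => x; rewrite mevalE.
apply: fun_subring_sum => // m; apply: (Am (fun=> P@_m)) => //.
by apply: fun_subring_prod => // i; apply: fun_subringX.
Qed.

Lemma fun_subring_mulmx (K : comNzRingType) (T : Type) (A : (T -> K) -> Prop)
    (m n p : nat) (M : T -> 'M[K]_(m, n)) (N : T -> 'M[K]_(n, p)) :
  fun_subring A -> (forall i j, A (fun x => M x i j)) ->
  (forall i j, A (fun x => N x i j)) ->
  forall i j, A (fun x => (M x *m N x) i j).
Proof.
move=> sA AM AN i j; have [_ _ Am] := sA.
rewrite (_ : (fun _ => _) = fun x => \sum_k M x i k * N x k j); last first.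
  by apply/funext => x; rewrite mxE.
by apply: fun_subring_sum => // k; apply: Am.
Qed.

Lemma fun_subring_det (K : comNzRingType) (T : Type) (A : (T -> K) -> Prop)
    (n : nat) (M : T -> 'M[K]_n) :
  fun_subring A -> (forall i j, A (fun x => M x i j)) ->
  A (fun x => \det (M x)).
Proof.
move=> sA AM; have [Ac _ Am] := sA.
apply: fun_subring_sum => // s; apply: Am => //.
exact: fun_subring_prod.
Qed.

Lemma fun_subring_adj (K : comNzRingType) (T : Type) (A : (T -> K) -> Prop)
    (n : nat) (M : T -> 'M[K]_n) :
  fun_subring A -> (forall i j, A (fun x => M x i j)) ->
  forall i j, A (fun x => (\adj (M x)) i j).
Proof.
move=> sA AM i j; have [Ac _ Am] := sA.
rewrite (_ : (fun _ => _) = fun x => (-1) ^+ (j + i) *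
   \det (row' j (col' i (M x)))); last first.
  by apply/funext => x; rewrite mxE.
apply: (Am (fun=> (-1) ^+ (j + i))) => //.
apply: fun_subring_det => // k l.
rewrite (_ : (fun _ => _) = fun x => M x (lift j k) (lift i l))//.
by apply/funext => x; rewrite !mxE.
Qed.

(** * Polynomial functions and fractions with a fixed denominator *)

Definition poly_fun (K : fieldType) (m p : nat) (f : 'M[K]_(m, p) -> K) :=
  exists P : {mpoly K[m * p]}, forall M, f M = mx_eval P M.

Lemma poly_fun_subring (K : fieldType) (m p : nat) :
  fun_subring (@poly_fun K m p).
Proof.
split=> [c|f g [P fP] [Q gQ]|f g [P fP] [Q gQ]].
- by exists c%:MP => M; rewrite /mx_eval mevalC.
- by exists (P + Q) => M; rewrite /mx_eval mevalD fP gQ.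
- by exists (P * Q) => M; rewrite /mx_eval mevalM fP gQ.
Qed.

Lemma poly_fun_entry (K : fieldType) (m p : nat) i j :
  poly_fun (fun M : 'M[K]_(m, p) => M i j).
Proof. by exists 'X_(mxvec_index i j) => M; rewrite /mx_eval mevalXU mxvecE. Qed.

Lemma poly_fun_eval (K : fieldType) (m p : nat) (P : {mpoly K[m * p]}) :
  poly_fun (mx_eval P : 'M[K]_(m, p) -> K).
Proof. by exists P. Qed.

Lemma poly_fun_mulmxl (K : fieldType) (k m p : nat) (A : 'M[K]_(k, m)) i j :
  poly_fun (fun M : 'M[K]_(m, p) => (A *m M) i j).
Proof.
have sA := @poly_fun_subring K m p; have [Ac _ _] := sA.
apply: (fun_subring_mulmx (M := fun=> A) (N := id)) => // i' j'.
exact: poly_fun_entry.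
Qed.

Lemma poly_fun_comp (K : fieldType) (m p m' p' : nat)
    (F : 'M[K]_(m', p') -> K) (phi : 'M[K]_(m, p) -> 'M[K]_(m', p')) :
  poly_fun F -> (forall i j, poly_fun (fun M => phi M i j)) ->
  poly_fun (F \o phi).
Proof.
move=> [P FP] pphi; rewrite (_ : F \o phi =
    fun M => P.@[fun k => mxvec (phi M) 0 k]); last first.
  by apply/funext => M /=; rewrite FP.
apply: fun_subring_meval; first exact: poly_fun_subring.
move=> k; case/mxvec_indexP: k => i j.
rewrite (_ : (fun _ => _) = fun M => phi M i j)//.
by apply/funext => M; rewrite mxvecE.
Qed.

(** The localization of the polynomial ring at [delta], seen as functions; values where [delta]
    vanishes are unconstrained. *)
Definition frac_fun (K : fieldType) (m p : nat) (delta : 'M[K]_(m, p) -> K)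
    (f : 'M[K]_(m, p) -> K) :=
  exists (Q : 'M[K]_(m, p) -> K) (d : nat),
    poly_fun Q /\ forall M, delta M != 0 -> f M = Q M / delta M ^+ d.

Lemma frac_fun_subring (K : fieldType) (m p : nat) (delta : 'M[K]_(m, p) -> K) :
  poly_fun delta -> fun_subring (frac_fun delta).
Proof.
move=> pd; have sA := @poly_fun_subring K m p; have [Ac Ad Am] := sA.
split=> [c|f g [P [d [pP fP]]] [Q [e [pQ gQ]]]|
  f g [P [d [pP fP]]] [Q [e [pQ gQ]]]].
- by exists (fun=> c), 0; split=> // M _; rewrite divr1.
- exists (fun M => P M * delta M ^+ e + Q M * delta M ^+ d), (d + e)%N; split.
    by apply: Ad; apply: Am => //; apply: fun_subringX.
  move=> M dM; rewrite fP// gQ// exprD.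
  have := expf_neq0 d dM; have := expf_neq0 e dM => de dd.
  by rewrite addf_div.
- exists (fun M => P M * Q M), (d + e)%N; split; first exact: Am.
  by move=> M dM; rewrite fP// gQ// exprD mulf_div.
Qed.

Lemma poly_frac_fun (K : fieldType) (m p : nat) (delta f : 'M[K]_(m, p) -> K) :
  poly_fun f -> frac_fun delta f.
Proof. by move=> pf; exists f, 0; split=> // M _; rewrite divr1. Qed.

Lemma frac_fun_inv (K : fieldType) (m p : nat) (delta : 'M[K]_(m, p) -> K) :
  frac_fun delta (fun M => (delta M)^-1).
Proof.
exists (fun=> 1), 1; split; last by move=> M _; rewrite div1r.
by have [Ac _ _] := @poly_fun_subring K m p.
Qed.

(** With its numerator multiplied by [delta], a fraction yields a principal open subset of the whole
    matrix space. *)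
Lemma frac_fun_neq0 (K : fieldType) (m p : nat) (delta f : 'M[K]_(m, p) -> K) :
  poly_fun delta -> frac_fun delta f ->
  exists2 Q, poly_fun Q & forall M, (Q M != 0) = (delta M != 0) && (f M != 0).
Proof.
move=> pd [Q [d [pQ fQ]]]; have [_ _ Am] := @poly_fun_subring K m p.
exists (fun M => delta M * Q M); first exact: Am.
move=> M; rewrite mulf_eq0 negb_or; case: eqP => //= /eqP dM.
by rewrite fQ// mulf_eq0 invr_eq0 expf_eq0 (negPf dM) andbF orbF.
Qed.

Lemma univ_fun_subring (K : comNzRingType) :
  fun_subring (fun f : K -> K => exists p : {poly K}, forall t, f t = p.[t]).
Proof.
split=> [c|f g [p fp] [q gq]|f g [p fp] [q gq]].
- by exists c%:P => t; rewrite hornerC.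
- by exists (p + q) => t; rewrite hornerD fp gq.
- by exists (p * q) => t; rewrite hornerM fp gq.
Qed.

(** A numeric field contains more distinct natural numbers than [p] has roots. *)
Lemma exists_nonroot (K : numFieldType) (p : {poly K}) :
  p != 0 -> exists t, p.[t] != 0.
Proof.
move=> p0; pose s := [seq i%:R : K | i <- iota 0 (size p)].
have us : uniq s.
  by rewrite map_inj_uniq ?iota_uniq// => i j /eqP; rewrite eqr_nat => /eqP.
have := max_poly_roots p0; case As: (all (root p) s).
  by move=> /(_ s As us); rewrite size_map size_iota ltnn.
move: As => /negbT /allPn[t _ rt] _; by exists t.
Qed.

(** Restricted to the line, [F] and [G] are univariate polynomials, nonzero at t = 0 and t = 1
    respectively, so their product has a nonroot. This is the form in which irreducibility of linear
    spaces is used. *)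
Lemma line_generic (K : numFieldType) (m p : nat) (F G : 'M[K]_(m, p) -> K)
    (M N : 'M[K]_(m, p)) :
  poly_fun F -> poly_fun G -> F M != 0 -> G N != 0 ->
  exists t, let L := (1 - t) *: M + t *: N in F L != 0 /\ G L != 0.
Proof.
move=> [P FP] [Q GQ] FM GN.
have sA := univ_fun_subring K; have [Ac Ad Am] := sA.
pose L t := (1 - t) *: M + t *: N.
have on_line (H : {mpoly K[m * p]}) :
    exists h : {poly K}, forall t, mx_eval H (L t) = h.[t].
  apply: (fun_subring_meval (A := fun f => exists p, forall t, f t = p.[t]) H
    (v := fun t k => mxvec (L t) 0 k)) => // k.
  case/mxvec_indexP: k => i j.
  exists ((1 - 'X) * (M i j)%:P + 'X * (N i j)%:P) => t.
  by rewrite mxvecE !mxE !hornerE.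
have [f fE] := on_line P; have [g gE] := on_line Q.
have L0 : L 0 = M by rewrite /L subr0 scale1r scale0r addr0.
have L1 : L 1 = N by rewrite /L subrr scale1r scale0r add0r.
have f0 : f != 0 by apply: contraNneq FM => f0; rewrite FP -L0 fE f0 horner0.
have g0 : g != 0 by apply: contraNneq GN => g0; rewrite GQ -L1 gE g0 horner0.
have [t] := exists_nonroot (mulf_neq0 f0 g0).
rewrite hornerM mulf_eq0 negb_or -fE -gE -FP -GQ => /andP[? ?].
by exists t.
Qed.

(** * Zariski-open sets and regular functions on them *)

Lemma zariski_openP (K : fieldType) (m p : nat) (U : set 'M[K]_(m, p)) :
  zariski_open U <->
  forall M, U M -> exists F, [/\ poly_fun F, F M != 0 &
                                forall N, F N != 0 -> U N].
Proof.
split=> [[S US] M /US[P SP PM]|US].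
  exists (mx_eval P); split=> //; first exact: poly_fun_eval.
  by move=> N PN; apply/US; exists P.
(* All polynomials whose nonvanishing locus lies in [U]. *)
exists [set P | forall N, mx_eval P N != 0 -> U N] => M; split.
  move=> /US[F [[P FP] FM FU]]; exists P; last by rewrite -FP.
  by move=> N; rewrite -FP; apply: FU.
by move=> [P]; apply.
Qed.

Lemma zariski_openI (K : fieldType) (m p : nat) (U V : set 'M[K]_(m, p)) :
  zariski_open U -> zariski_open V -> zariski_open (U `&` V).
Proof.
move=> /zariski_openP oU /zariski_openP oV; apply/zariski_openP => M [].
move=> /oU[F [pF FM FU]] /oV[G [pG GM GV]].
have [_ _ Am] := @poly_fun_subring K m p.
exists (fun M => F M * G M); split; [exact: Am| |].
  by rewrite mulf_neq0.
by move=> N; rewrite mulf_eq0 negb_or => /andP[/FU UN /GV VN].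
Qed.

Lemma zariski_open_neq0 (K : fieldType) (m p : nat) (F : 'M[K]_(m, p) -> K) :
  poly_fun F -> zariski_open [set M | F M != 0].
Proof. by move=> pF; apply/zariski_openP => M FM; exists F; split. Qed.

Lemma zariski_regularS (K : fieldType) (m p : nat) (U V : set 'M[K]_(m, p)) f g :
  zariski_open V -> V `<=` U -> (forall M, V M -> f M = g M) ->
  zariski_regular U f -> zariski_regular V g.
Proof.
move=> oV VU fg rf M VM; have [W [P [Q [oW WM WU PQ]]]] := rf M (VU M VM).
exists (W `&` V), P, Q; split=> //; first exact: zariski_openI.
by move=> N [WN VN]; rewrite -fg//; apply: PQ.
Qed.

(** * Pullback along a map whose entries are fractions over [delta] *)

Section FracMap.
Context (K : fieldType) (m p m' p' : nat) (delta : 'M[K]_(m, p) -> K)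
  (phi : 'M[K]_(m, p) -> 'M[K]_(m', p')).
Hypotheses (pdelta : poly_fun delta)
  (fphi : forall i j, frac_fun delta (fun M => phi M i j)).

Lemma frac_fun_comp F : poly_fun F -> frac_fun delta (F \o phi).
Proof.
move=> [P FP]; rewrite (_ : F \o phi =
    fun M => P.@[fun k => mxvec (phi M) 0 k]); last first.
  by apply/funext => M /=; rewrite FP.
apply: fun_subring_meval; first exact: frac_fun_subring.
move=> k; case/mxvec_indexP: k => i j.
rewrite (_ : (fun _ => _) = fun M => phi M i j)//.
by apply/funext => M; rewrite mxvecE.
Qed.

Lemma zariski_open_preimage V :
  zariski_open V -> zariski_open [set M | delta M != 0 /\ V (phi M)].
Proof.
move=> /zariski_openP oV; apply/zariski_openP => M [dM] /oV[F [pF FM FV]].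
have [Q pQ QE] := frac_fun_neq0 pdelta (frac_fun_comp pF).
exists Q; split=> //; first by rewrite QE dM.
by move=> N; rewrite QE => /andP[dN FN]; split=> //; apply: FV.
Qed.

Lemma zariski_regular_preimage V f :
  zariski_regular V f ->
  zariski_regular [set M | delta M != 0 /\ V (phi M)] (f \o phi).
Proof.
move=> rf M [dM VM]; have [W [P [Q [oW WM WV PQ]]]] := rf _ VM.
have [P' [d [[P'' P'E] PE]]] := frac_fun_comp (poly_fun_eval P).
have [Q' [e [[Q'' Q'E] QE]]] := frac_fun_comp (poly_fun_eval Q).
have sA := @poly_fun_subring K m p; have [_ _ Am] := sA.
(* If [P] and [Q] pull back to P' / delta^d and Q' / delta^e, their quotient pulls back to P'
   delta^e / (Q' delta^d); [A] and [B] are this numerator and denominator. *)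
have [A AE] := Am _ _ (poly_fun_eval P'') (fun_subringX e sA pdelta).
have [B BE] := Am _ _ (poly_fun_eval Q'') (fun_subringX d sA pdelta).
exists [set M | delta M != 0 /\ W (phi M)], A, B; split=> //.
- exact: zariski_open_preimage.
- by move=> N [dN WN]; split=> //; apply: WV.
- move=> N [dN WN]; have [QN fN] := PQ _ WN.
  have dd := expf_neq0 d dN; have de := expf_neq0 e dN.
  have := PE _ dN; have := QE _ dN; rewrite /= => QN' PN'.
  move: QN; rewrite QN' mulf_eq0 negb_or => /andP[QN _].
  rewrite -AE -BE -P'E -Q'E; split; first exact: mulf_neq0.
  by rewrite /= fN PN' QN' invf_div mulf_div [delta N ^+ d * _]mulrC.
Qed.

End FracMap.

(** * Spaces with functions *)

Lemma morphism_subspace (K : fieldType) (X Y : space K)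
    (f : ambient X -> ambient Y) A B :
  morphism X Y f -> (forall x, carrier X x -> A x -> B (f x)) ->
  morphism (subspace X A) (subspace Y B) f.
Proof.
move=> [fXY fopen] fAB; split=> [x [Xx Ax]|_ [V oV ->]].
  by split; [exact: fXY | exact: fAB].
have [oV' _] := fopen V oV; split.
  exists (carrier X `&` f @^-1` V) => //; apply/seteqP; split=> x /=.
    by move=> [[Xx Ax] [Vx _]].
  by move=> [[Xx Vx] Ax]; split=> //; split=> //; exact: fAB.
move=> g rg x [[Xx Ax] Vx]; have [W [h [oW Wx rh gh]]] := rg _ Vx.
have [oW' rW] := fopen W oW; exists (carrier X `&` f @^-1` W), (h \o f).
by split=> //; [exact: rW | move=> y [Xy Wy] [_ Vy]; exact: gh].
Qed.

(** The record [space] imposes no axioms; these two closure properties are what the comparison of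
    iterated subspaces uses. *)
Definition local_space (K : fieldType) (X : space K) : Prop :=
  (forall U V, is_open X U -> is_open X V -> is_open X (U `&` V)) /\
  (forall U V g, is_open X V -> V `<=` U -> regular X U g -> regular X V g).

Lemma is_open_subspace_subspace (K : fieldType) (X : space K) A B U :
  is_open (subspace (subspace X A) B) U <-> is_open (subspace X (A `&` B)) U.
Proof.
split=> [[_ [V oV ->] ->]|[V oV ->]]; first by exists V => //; rewrite setIA.
by exists (V `&` A); [exists V | rewrite setIA].
Qed.

(** Extending first to an open subset of [A] and then to one of [X] amounts to a single extension,
    on the intersection of the two neighbourhoods. *)
Lemma regular_subspace_subspace (K : fieldType) (X : space K) A B
    (U : set (ambient X)) f :
  local_space X -> U `<=` A ->
  regular (subspace (subspace X A) B) U f <->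
  regular (subspace X (A `&` B)) U f.
Proof.
move=> [XI XS] UA; split=> rf x Ux.
  have [_ [g [[W oW ->] [Wx Ax] rg fg]]] := rf x Ux.
  have [W' [h [oW' W'x rh gh]]] := rg x (conj Wx Ax).
  exists (W' `&` W), h; split=> //; first exact: XI.
    by apply: XS rh => //; exact: XI.
  move=> y [W'y Wy] Uy; have Ay := UA y Uy.
  by rewrite fg// gh.
have [W [g [oW Wx rg fg]]] := rf x Ux; exists (W `&` A), g; split=> //.
- by exists W.
- by split=> //; exact: UA.
- by move=> y [Wy Ay]; exists W, g.
- by move=> y [Wy Ay]; apply: fg.
Qed.

Lemma morphism_from_subspace_subspace (K : fieldType) (X Y : space K) A B f :
  local_space X ->
  @morphism K (subspace (subspace X A) B) Y f <->
  @morphism K (subspace X (A `&` B)) Y f.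
Proof.
move=> lX.
have cE : carrier (subspace (subspace X A) B) = carrier (subspace X (A `&` B)).
  exact: esym (setIA _ _ _).
have sub V : carrier (subspace X (A `&` B)) `&` f @^-1` V `<=` A.
  by move=> x [[_ []]].
have rE V (g : ambient Y -> K) :=
  @regular_subspace_subspace K X A B _ (g \o f) lX (sub V).
rewrite /morphism cE.
split=> -[fc fo]; split=> // V oV; have [o r] := fo V oV; split.
- exact: (@is_open_subspace_subspace K X A B _).1.
- by move=> g /r; exact: (rE V g).1.
- exact: (@is_open_subspace_subspace K X A B _).2.
- by move=> g /r; exact: (rE V g).2.
Qed.

Lemma morphism_to_subspace_subspace (K : fieldType) (X Y : space K) A B f :
  local_space Y -> @morphism K X (subspace Y (A `&` B)) f ->
  @morphism K X (subspace (subspace Y A) B) f.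
Proof.
move=> lY [fc fo]; split=> [x /fc [Yx [Ax Bx]]//|V /is_open_subspace_subspace oV].
have [o r] := fo V oV; split=> // g rg; apply: r.
have VA : V `<=` A by case: oV => W _ -> x [_ []].
exact: (@regular_subspace_subspace K Y A B V g lY VA).1.
Qed.

Lemma framesI (K : fieldType) (k m : nat) (U V : set {vspace 'cV[K]_m}) :
  frames k (U `&` V) = frames k U `&` frames k V.
Proof. by apply/seteqP; split=> M /=; rewrite /frames/=; tauto. Qed.

Lemma local_Gr (K : fieldType) (k m : nat) : local_space (Gr K k m).
Proof.
split=> [U V [Uk oU] [Vk oV]|U V g [Vk oV] VU].
  split; first by move=> x [/Uk].
  by rewrite framesI; exact: zariski_openI.
apply: zariski_regularS => //.
by move=> M [rM VM]; split=> //; apply: VU.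
Qed.

(** An isomorphism [f] of [X] onto the open set [C] restricts to the preimage [A] of [B]; the image
    is the open subset of [B] cut out by [C], and the inverse is the restriction of [g]. *)
Lemma open_immersionI (K : fieldType) (X Y : space K) (A : set (ambient X))
    (B C : set (ambient Y)) f g :
  local_space Y -> is_open Y C ->
  morphism X Y f -> morphism (subspace Y C) X g ->
  (forall x, carrier X x -> C (f x)) ->
  (forall x, carrier X x -> A x <-> B (f x)) ->
  (forall x, carrier X x -> g (f x) = x) ->
  (forall y, carrier Y y -> C y -> f (g y) = y) ->
  open_immersion (subspace X A) (subspace Y B) f.
Proof.
move=> lY oC mf mg fC AB fK gK; exists (C `&` B); first by exists C.
split.
  apply: morphism_to_subspace_subspace => //.
  apply: morphism_subspace => // x Xx Ax.
  have Bx := (AB x Xx).1 Ax; have Cx := fC x Xx.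
  by split.
exists g; split.
(* The source of the inverse, an open subset of the subspace [B], is rewritten as a subspace of [C],
   where [g] is known to be a morphism. *)
- apply/morphism_from_subspace_subspace => //.
  have -> : B `&` (C `&` B) = C `&` B by rewrite setIA [B `&` C]setIC -setIA setIid.
  apply/morphism_from_subspace_subspace => //.
  apply: morphism_subspace => // y [Yy Cy] By.
  apply/AB; first by apply: mg.1.
  by rewrite gK.
- by move=> x [Xx _]; apply: fK.
- by move=> y [[Yy _] [Cy _]]; apply: gK.
Qed.

(** * Column spaces and the standard flag *)

Lemma Col_limg (K : fieldType) (m p : nat) (M : 'M[K]_(m, p)) :
  Col M = (linfun (mulmx M) @: fullv)%VS.
Proof.
apply/eqP; rewrite eqEsubv; apply/andP; split.
  apply/span_subvP => _ /mapP[j _ ->]; rewrite colE.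
  have -> : M *m delta_mx j 0 = linfun (mulmx M) (delta_mx j 0 : 'cV_p).
    by rewrite lfunE.
  by rewrite memv_img ?memvf.
apply/subvP => _ /memv_imgP[c _ ->]; rewrite lfunE /=.
have -> : M *m c = \sum_j c j 0 *: col j M.
  apply/colP => i; rewrite mxE summxE; apply: eq_bigr => j _.
  by rewrite !mxE mulrC.
apply: memv_suml => j _; apply/memvZ/memv_span/mapP.
by exists j; rewrite ?mem_enum.
Qed.

Lemma memColP (K : fieldType) (m p : nat) (M : 'M[K]_(m, p)) v :
  reflect (exists c, v = M *m c) (v \in Col M).
Proof.
rewrite Col_limg; apply: (iffP memv_imgP) => [[c _ ->]|[c ->]].
  by exists c; rewrite lfunE.
by exists c; rewrite ?memvf ?lfunE.
Qed.

Lemma Col_subP (K : fieldType) (m p q : nat) (M : 'M[K]_(m, p))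
    (N : 'M[K]_(m, q)) :
  reflect (exists A, M = N *m A) (Col M <= Col N)%VS.
Proof.
apply: (iffP subvP) => [MN|[A ->] _ /memColP[c ->]]; last first.
  by apply/memColP; exists (A *m c); rewrite mulmxA.
have /choice[a aE] j : exists c, col j M = N *m c.
  by apply/memColP/MN/memColP; exists (delta_mx j 0); rewrite -colE.
exists (\matrix_(i, j) a j i 0); apply/matrixP => i j.
have /colP/(_ i) := aE j; rewrite !mxE => ->.
by apply: eq_bigr => k _; rewrite !mxE.
Qed.

Lemma Col_mulmx_unit (K : fieldType) (m p : nat) (M : 'M[K]_(m, p))
    (g : 'M[K]_p) :
  g \in unitmx -> Col (M *m g) = Col M.
Proof.
move=> ug; apply/eqP; rewrite eqEsubv; apply/andP; split; apply/Col_subP.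
  by exists g.
by exists (invmx g); rewrite mulmxK.
Qed.

Lemma mx_act_Col (K : fieldType) (m p : nat) (g : 'M[K]_m) (M : 'M[K]_(m, p)) :
  mx_act g (Col M) = Col (g *m M).
Proof.
rewrite /mx_act !Col_limg -limg_comp; congr (_ @: _)%VS.
by apply/lfunP => c; rewrite comp_lfunE !lfunE /= mulmxA.
Qed.

Lemma exists_frame (K : fieldType) (m k : nat) (V : {vspace 'cV[K]_m}) :
  \dim V = k -> exists2 M : 'M[K]_(m, k), Col M = V & \rank M = k.
Proof.
move=> <-.
pose M : 'M[K]_(m, \dim V) := \matrix_(i, j) (vbasis V)`_j i 0.
have colM j : col j M = (vbasis V)`_j by apply/colP => i; rewrite !mxE.
exists M.
  rewrite -[RHS](span_basis (vbasisP V)); congr <<_>>%VS.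
  apply: (@eq_from_nth _ 0) => [|i].
    by rewrite size_map size_enum_ord size_tuple.
  rewrite size_map size_enum_ord => iV.
  by rewrite (nth_map (Ordinal iV)) ?size_enum_ord// colM nth_enum_ord.
rewrite -mxrank_tr; apply/eqP/inj_row_free => v vM.
have /freeP fV := basis_free (vbasisP V).
apply/rowP => j; rewrite mxE; apply: (fV (v 0)).
apply/colP => i; have /rowP/(_ i) := vM.
rewrite [LHS]mxE [RHS]mxE => vMi; rewrite summxE [RHS]mxE -[RHS]vMi.
by apply: eq_bigr => l _; rewrite !mxE.
Qed.

(** [M] and a frame of its column space factor through each other, so their ranks agree. *)
Lemma dim_Col (K : fieldType) (m p : nat) (M : 'M[K]_(m, p)) :
  \dim (Col M) = \rank M.
Proof.
have [N NE rN] := exists_frame (erefl (\dim (Col M))).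
have [A MA] : exists A, M = N *m A by apply/Col_subP; rewrite NE subvv.
have [B NB] : exists B, N = M *m B by apply/Col_subP; rewrite NE subvv.
apply/eqP; rewrite -{1}rN eqn_leq {1}NB mxrankM_maxl /=.
by rewrite [in leqLHS]MA mxrankM_maxl.
Qed.

(** The fibres of [Col] on frames are orbits of the general linear group: the factor [g] has rank at
    least that of [M *m g], which is [p]. *)
Lemma Col_eqP (K : fieldType) (m p : nat) (M N : 'M[K]_(m, p)) :
  \rank M = p -> Col M = Col N -> exists2 g, g \in unitmx & N = M *m g.
Proof.
move=> rM MN.
have [g NM] : exists g, N = M *m g by apply/Col_subP; rewrite MN subvv.
exists g => //; rewrite -row_free_unit -row_leq_rank.
by rewrite -{1}rM -dim_Col MN dim_Col NM mxrankM_maxr.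
Qed.

(** * Coordinate truncations and the standard flag *)

Lemma mul_copid_mxE (K : fieldType) (m p k : nat) (M : 'M[K]_(m, p)) i j :
  (copid_mx k *m M) i j = if (k <= i)%N then M i j else 0.
Proof.
rewrite mulmxBl mul1mx !mxE.
under eq_bigr do rewrite mxE.
rewrite (bigD1 i)//= eqxx big1 => [|l li]; last first.
  by rewrite eq_sym (_ : (_ == _) = false) ?mul0r//; apply/negbTE.
by rewrite addr0; case: ltnP => _; rewrite ?mul1r ?subrr// mul0r subr0.
Qed.

Lemma mul_mx_pidE (K : fieldType) (m n k : nat) (M : 'M[K]_(m, n)) i j :
  (M *m (pid_mx k : 'M_n)) i j = if (j < k)%N then M i j else 0.
Proof.
rewrite mxE (bigD1 j)//= mxE eqxx /= big1 => [|l lj]; last first.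
  by rewrite mxE (_ : (_ == _) = false) ?mulr0//; apply/negbTE.
by rewrite addr0; case: ltnP => _; rewrite ?mulr1 ?mulr0.
Qed.

Lemma mul_pid_mxE (K : fieldType) (m n k : nat) (M : 'M[K]_(m, n)) i j :
  ((pid_mx k : 'M_m) *m M) i j = if (i < k)%N then M i j else 0.
Proof.
rewrite mxE (bigD1 i)//= mxE eqxx /= big1 => [|l li]; last first.
  by rewrite mxE eq_sym (_ : (_ == _) = false) ?mul0r//; apply/negbTE.
by rewrite addr0; case: ltnP => _; rewrite ?mul1r ?mul0r.
Qed.

Lemma mem_flag_space (K : fieldType) (m k : nat) (v : 'cV[K]_m) :
  (v \in flag_space K m k) = (copid_mx k *m v == 0).
Proof.
apply/idP/eqP => [|v0].
  pose f : 'Hom('cV[K]_m, 'cV[K]_m) := linfun (mulmx (copid_mx k)).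
  rewrite /flag_space => vF; have : v \in lker f.
    move: v vF; apply/subvP/span_subvP => u.
    case/mapP => i; rewrite mem_filter => /andP[ik _] ->; rewrite memv_ker lfunE /=.
    apply/eqP/colP => j; rewrite mul_copid_mxE !mxE.
    case: leqP => // kj; have /negPf-> // : j != i.
    by apply: contraTneq ik => <-; rewrite -leqNgt.
  by rewrite memv_ker lfunE /= => /eqP.
rewrite (matrix_sum_delta v); apply: memv_suml => i _.
rewrite big_ord1; case: (ltnP i k) => ik.
  apply: memvZ; apply: memv_span; apply: (map_f (fun j => delta_mx j ord0)).
  by rewrite mem_filter ik mem_enum.
have /colP/(_ i) := v0; rewrite mul_copid_mxE ik mxE => ->.
by rewrite scale0r mem0v.
Qed.

(** Rank-nullity for [copid_mx k] on the sum: the kernel is the flag space, the image is the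
    truncated column space. *)
Lemma dim_add_flag (K : fieldType) (m p k : nat) (M : 'M[K]_(m, p)) :
  (k <= m)%N ->
  \dim (Col M + flag_space K m k)%VS = (k + \rank (copid_mx k *m M))%N.
Proof.
move=> km; pose f : 'Hom('cV[K]_m, 'cV[K]_m) := linfun (mulmx (copid_mx k)).
have fE q (N : 'M[K]_(m, q)) : (f @: Col N)%VS = Col (copid_mx k *m N).
  exact: mx_act_Col.
have kerf : lker f = flag_space K m k.
  by apply/vspaceP => v; rewrite mem_flag_space memv_ker lfunE.
have f0 : (f @: flag_space K m k)%VS = 0%VS.
  by apply/eqP; rewrite -kerf -lkerE subvv.
have dimF : \dim (flag_space K m k) = k.
  have := limg_ker_dim f (Col 1%:M).
  rewrite fE !dim_Col mulmx1 rank_copid_mx// mxrank1 kerf.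
  have -> : (Col 1%:M :&: flag_space K m k)%VS = flag_space K m k.
    apply/capv_idPr/subvP => v _; apply/memColP; exists v.
    by rewrite mul1mx.
  by move/eqP; rewrite -[eqbRHS](subnKC km) eqn_add2r => /eqP.
have := limg_ker_dim f (Col M + flag_space K m k).
rewrite limgD fE f0 addv0 dim_Col kerf.
by rewrite (capv_idPr (addvSr _ _)) dimF.
Qed.

(** Inclusion of row spaces is reverse inclusion of kernels; the witness is a column of the cokernel
    of [A]. *)
Lemma exists_ker_notin_ker (K : fieldType) (m m' p : nat) (A : 'M[K]_(m, p))
    (B : 'M[K]_(m', p)) :
  ~~ (B <= A)%MS -> exists c : 'cV_p, A *m c = 0 /\ B *m c != 0.
Proof.
rewrite submxE => /matrix0Pn[i [j Bij]]; exists (col j (cokermx A)).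
rewrite colE ![_ *m (_ *m delta_mx _ _)]mulmxA mulmx_coker mul0mx -colE; split=> //.
by apply: contraNneq Bij => /colP/(_ i); rewrite !mxE => ->.
Qed.

(** * Schubert varieties in Grassmannians *)

(** Lower semicontinuity of the rank, witnessed by one polynomial: [L] and [R] reduce [A] to the
    identity of size its rank, and det (L B R) being nonzero forces [B] to have at least this
    rank. *)
Lemma rank_ge_open (K : fieldType) (m p : nat) (A : 'M[K]_(m, p)) :
  exists F, [/\ poly_fun F, F A != 0 &
                forall B, F B != 0 -> (\rank A <= \rank B)%N].
Proof.
pose r := \rank A.
pose L : 'M[K]_(r, m) := pid_mx r *m invmx (col_ebase A).
pose R : 'M[K]_(p, r) := invmx (row_ebase A) *m pid_mx r.
have sA := @poly_fun_subring K m p; have [Ac _ _] := sA.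
exists (fun B => \det (L *m B *m R)); split.
- apply: fun_subring_det => // i j.
  apply: (fun_subring_mulmx (N := fun=> R)) => //.
  exact: poly_fun_mulmxl.
- have -> : L *m A *m R = 1%:M.
    rewrite -[A in L *m A]mulmx_ebase /L /R !mulmxA mulmxKV ?col_ebase_unit//.
    rewrite mulmxK ?row_ebase_unit//.
    by rewrite !pid_mx_id ?rank_leq_row ?rank_leq_col// pid_mx_1.
  by rewrite det1 oner_eq0.
- move=> B; rewrite -unitfE -[_ \is a _]/(_ \in unitmx) -row_free_unit.
  move=> /eqP rB; rewrite -/r -{1}rB.
  by apply: leq_trans (mxrankM_maxl _ _) (mxrankM_maxr _ _).
Qed.

(** Greedy choice: the first i vectors span dimension at most i, so they cannot exhaust [U i]. *)
Lemma exists_free_tuple (K : fieldType) (vT : vectType K) (n : nat)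
    (U : nat -> {vspace vT}) :
  (forall i, (i < n)%N -> (i < \dim (U i))%N) ->
  exists2 X : n.-tuple vT, free X & forall i : 'I_n, X`_i \in U i.
Proof.
elim: n => [|n IHn] dU; first by exists [tuple]; [exact: nil_free | case].
have [i ltin|X fX XU] := IHn; first by apply: dU; apply: ltnW.
have /subvPn[u uU uX] : ~~ (U n <= <<X>>)%VS.
  apply/negP => /dimvS; rewrite leqNgt; apply/negP; rewrite negbK.
  by apply: leq_ltn_trans (dim_span X) _; rewrite size_tuple dU.
exists [tuple of rcons X u].
  by rewrite (perm_free (Y := u :: X)) ?free_cons ?uX// perm_rcons.
move=> i; rewrite nth_rcons size_tuple; case: ltnP => [lin|lni].
  exact: (XU (Ordinal lin)).
have -> : i = n :> nat by apply/eqP; rewrite eqn_leq lni -ltnS ltn_ord.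
by rewrite eqxx.
Qed.

(** By rank-nullity the right-hand side says that the space meets E_(v i + 1) in dimension at least
    i + 1. *)
Lemma Gr_schubert_ColP (K : fieldType) (k m : nat) (v : 'I_k -> 'I_m)
    (M : 'M[K]_(m, k)) :
  \rank M = k ->
  Gr_schubert K v (Col M) <->
  forall i, (\rank (copid_mx (v i).+1 *m M) + i.+1 <= k)%N.
Proof.
move=> rM; rewrite /Gr_schubert/= dim_Col rM.
have E i : (\dim (Col M + flag_space K m (v i).+1)%VS + i.+1 <= k + (v i).+1)%N
    = (\rank (copid_mx (v i).+1 *m M) + i.+1 <= k)%N.
  by rewrite dim_add_flag// addnC addnCA [leqRHS]addnC leq_add2l addnC.
by split=> [[_ H] i|H]; [rewrite -E | split=> // i; rewrite E].
Qed.

(** Column [i] lies in [flag_space K m (v i).+1]. The condition is linear, hence persists along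
    lines between adapted frames. *)
Definition adapted (K : fieldType) (k m : nat) (v : 'I_k -> 'I_m)
    (N : 'M[K]_(m, k)) :=
  forall (j : 'I_m) (i : 'I_k), (v i < j)%N -> N j i = 0.

(** The coefficient vectors that [M] sends into E_(v i + 1) form a kernel of dimension at least i +
    1, so a free family can be picked greedily from these kernels. *)
Lemma exists_adapted (K : fieldType) (k m : nat) (v : 'I_k -> 'I_m)
    (M : 'M[K]_(m, k)) :
  \rank M = k -> Gr_schubert K v (Col M) ->
  exists2 g, g \in unitmx & adapted v (M *m g).
Proof.
move=> rM /(Gr_schubert_ColP v rM) vM.
pose f (i : 'I_k) : 'Hom('cV[K]_k, 'cV[K]_m) :=
  linfun (mulmx (copid_mx (v i).+1 *m M)).
(* The full space is a default for indices outside ['I_k]. *)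
pose U i := if insub i is Some j then lker (f j) else fullv.
have [i lik|X fX XU] := @exists_free_tuple K 'cV[K]_k k U.
  rewrite /U insubT; have := limg_ker_dim (f (Ordinal lik)) fullv.
  rewrite capfv -Col_limg dim_Col dimvf /dim/= muln1 => dimk. 
  by have := vM (Ordinal lik); rewrite -[leqRHS]dimk addnC leq_add2r.
pose g : 'M[K]_k := \matrix_(i, j) X`_j i 0; exists g.
  rewrite -unitmx_tr -row_free_unit; apply: inj_row_free => c cg.
  apply/rowP => j; rewrite mxE; move/freeP: fX => /(_ (c 0)); apply.
  apply/colP => i; have /rowP/(_ i) := cg.
  rewrite [LHS]mxE [RHS]mxE => cgi; rewrite summxE [RHS]mxE -[RHS]cgi.
  by apply: eq_bigr => l _; rewrite !mxE.
move=> j i vij; have := XU i; rewrite /U valK memv_ker lfunE /=.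
move=> /eqP/colP/(_ j); rewrite -mulmxA mul_copid_mxE vij [RHS]mxE => <-.
by rewrite !mxE; apply: eq_bigr => l _; rewrite mxE.
Qed.

(** As [v] increases, the columns up to [i] all lie in E_(v i + 1); truncation kills them, and at
    most k - i - 1 columns survive. *)
Lemma Gr_schubert_adapted (K : fieldType) (k m : nat) (v : 'I_k -> 'I_m)
    (N : 'M[K]_(m, k)) :
  {homo v : i j / (i < j)%N} -> \rank N = k -> adapted v N ->
  Gr_schubert K v (Col N).
Proof.
move=> vinc rN aN; apply/Gr_schubert_ColP => // i.
have vS (j : 'I_k) : (j <= i)%N -> (v j <= v i)%N.
  by rewrite leq_eqVlt => /predU1P[/val_inj->//|/vinc/ltnW].
have -> : copid_mx (v i).+1 *m N = copid_mx (v i).+1 *m N *m copid_mx i.+1.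
  rewrite mulmxBr mulmx1; apply/matrixP => a b.
  rewrite [RHS]mxE [X in _ + X]mxE mul_mx_pidE mul_copid_mxE.
  case: ltnP => via; case: ltnP => bi; rewrite ?subr0 ?subrr//.
  by rewrite aN ?subr0// (leq_ltn_trans (vS b _)).
apply: (@leq_trans (k - i.+1 + i.+1)); last by rewrite subnK.
by rewrite leq_add2r -[leqRHS](rank_copid_mx K)// mxrankM_maxr.
Qed.

(** [b] has column [i] of [N] in position [v i] and unit vectors elsewhere: adaptedness makes it
    upper triangular, and the entries [N (v i) i] are the diagonal entries in these positions. *)
Lemma adapted_orbit (K : fieldType) (k m : nat) (v : 'I_k -> 'I_m)
    (N : 'M[K]_(m, k)) :
  injective v -> adapted v N -> (forall i, N (v i) i != 0) ->
  exists2 b, borel K m b & N = b *m \matrix_(j, i) (j == v i)%:R.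
Proof.
move=> vinj aN N0.
pose b : 'M[K]_m := \matrix_(j, l)
  (if [pick i | v i == l] is Some i then N j i else (j == l)%:R).
have bup (i j : 'I_m) : (j < i)%N -> b i j = 0.
  rewrite mxE; case: pickP => [l /eqP <-|_ ji]; first exact: aN.
  by rewrite (_ : (_ == _) = false)//; apply: contraTF ji => /eqP->; rewrite ltnn.
exists b.
  split=> //; rewrite -unitmx_tr unitmxE det_trig; last first.
    by apply/is_trig_mxP => i j ij; rewrite mxE bup.
  rewrite unitfE; apply/prodf_neq0 => i _; rewrite !mxE.
  by case: pickP => [l /eqP <-//|_]; rewrite eqxx oner_eq0.
apply/matrixP => j i; rewrite mxE (bigD1 (v i))//= big1 => [|l li].
  rewrite !mxE eqxx mulr1 addr0; case: pickP => [l /eqP/vinj->//|/(_ i)].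
  by rewrite eqxx.
by rewrite mxE [_ == _]eq_sym [_ == _]eq_sym (negPf li) mulr0.
Qed.

(** Semicontinuity of the rank is applied twice: to the frame, which must keep rank [k], and to its
    truncation. *)
Lemma zariski_open_frames_flag (K : fieldType) (m k l r : nat) :
  (l <= m)%N ->
  zariski_open (frames k [set V : {vspace 'cV[K]_m} |
    (\dim V = k) /\ (r < \dim (V + flag_space K m l)%VS)%N]).
Proof.
move=> lm; apply/zariski_openP => M [rM [_]]; rewrite dim_add_flag// => rl.
have [F [pF FM FN]] := rank_ge_open M.
have [G [pG GM GN]] := rank_ge_open (copid_mx l *m M).
have sA := @poly_fun_subring K m k; have [_ _ Am] := sA.
exists (fun N => F N * G (copid_mx l *m N)); split.
- apply: Am => //.
  apply: (poly_fun_comp (phi := mulmx (copid_mx l)) pG) => i j.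
  exact: poly_fun_mulmxl.
- by rewrite mulf_neq0.
- move=> N; rewrite mulf_eq0 negb_or => /andP[/FN rN /GN rlN].
  have rNk : \rank N = k by apply/eqP; rewrite eqn_leq rank_leq_col -{1}rM.
  split=> //; rewrite /= dim_Col; split=> //.
  by rewrite dim_add_flag//; apply: leq_trans rl _; rewrite leq_add2l.
Qed.

(** The orbit is that of the coordinate subspace spanned by the e_(v i). A line from an adapted
    frame of [V] to the frame of this subspace has its general points in the orbit, so [V] lies in
    the closure. Conversely, the conditions are closed and hold on the orbit. *)
Lemma Gr_schubert_variety (K : numFieldType) (k m : nat) (v : 'I_k -> 'I_m) :
  {homo v : i j / (i < j)%N} -> is_schubert_variety k m (Gr_schubert K v).
Proof.
move=> vinc.
have vinj : injective v.
  move=> i j vij; case: (ltngtP i j) => [/vinc|/vinc|/val_inj//];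
  by rewrite vij ltnn.
pose N0 : 'M[K]_(m, k) := \matrix_(j, i) (j == v i)%:R.
have aN0 : adapted v N0.
  move=> j i vij; rewrite mxE (_ : (_ == _) = false)//.
  by apply: contraTF vij => /eqP->; rewrite ltnn.
have rN0 : \rank N0 = k.
  rewrite -mxrank_tr; apply/eqP/inj_row_free => c cN; apply/rowP => i.
  have /rowP/(_ (v i)) := cN; rewrite mxE (bigD1 i)//= !mxE eqxx mulr1 big1 ?addr0//.
  by move=> j ji; rewrite !mxE (inj_eq vinj) eq_sym (negPf ji) mulr0.
exists (Col N0); first by rewrite dim_Col.
apply/seteqP; split=> V.
  move=> VG; have [dV _] := VG; split=> // U [_ oU] UV.
  have [M MV rM] := exists_frame dV.
  have [|g ug aN] := exists_adapted rM (v := v); first by rewrite MV.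
  have [|F [pF FM FU]] := (zariski_openP _).1 oU (M *m g).
    by split; [rewrite mxrankMfree ?row_free_unit | rewrite Col_mulmx_unit ?MV].
  have sA := @poly_fun_subring K m k.
  (* Nonvanishing of this product of pivots puts an adapted frame in the orbit. *)
  have pG : poly_fun (fun N : 'M[K]_(m, k) => \prod_i N (v i) i).
    by apply: fun_subring_prod => // i; exact: poly_fun_entry.
  have G0 : \prod_i N0 (v i) i != 0.
    by apply/prodf_neq0 => i _; rewrite mxE eqxx oner_eq0.
  have [t /= [FL /prodf_neq0 GL]] := line_generic pF pG FM G0.
  set L := _ + _ in FL GL.
  have aL : adapted v L.
    move=> j i vij; rewrite [LHS]mxE [X in X + _]mxE [X in _ + X]mxE.
    by rewrite aN// aN0// !mulr0 addr0.
  have [|b bB Lb] := adapted_orbit vinj aL; first by move=> i; apply: GL.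
  have [rL UL] := FU L FL; exists (Col L); split=> //.
  by exists b => //; rewrite mx_act_Col Lb.
move=> [dV clV]; split=> // i; rewrite leqNgt; apply/negP => ltr.
pose r := (k + (v i).+1 - i.+1)%N.
have rE (W : {vspace 'cV[K]_m}) :
    (r < \dim (W + flag_space K m (v i).+1)%VS)%N =
    (k + (v i).+1 < \dim (W + flag_space K m (v i).+1)%VS + i.+1)%N.
  by rewrite (addnC _ i.+1) /r ltn_subLR// (leq_trans (ltn_ord i))// leq_addr.
(* If the condition failed at [V], this open set of spaces violating it would meet the orbit. *)
pose U := [set W : {vspace 'cV[K]_m} |
    (\dim W = k) /\ (r < \dim (W + flag_space K m (v i).+1)%VS)%N].
have oU : is_open (Gr K k m) U.
  by split=> [W []//|]; exact: zariski_open_frames_flag.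
have [|W [[_ Wr] [b [ub bup] bW]]] := clV U oU; first by split=> //; rewrite rE.
move: Wr; rewrite -bW rE ltnNge => /negP; apply.
rewrite mx_act_Col; have [||_ //] := @Gr_schubert_adapted K k m v (b *m N0) vinc.
- by rewrite eqmxMfull ?row_full_unit.
- move=> j l vlj; rewrite mxE (bigD1 (v l))//= bup// mul0r add0r big1// => c cl.
  by rewrite mxE (negPf cl) mulr0.
Qed.

(** * South-west ranks *)

(** Padding the block with zeros keeps its rank and gives all blocks the same type. *)
Definition sw_mx (K : fieldType) (n p q : nat) (x : 'M[K]_n) : 'M[K]_n :=
  copid_mx p *m x *m pid_mx q.

Lemma sw_mxE (K : fieldType) (n p q : nat) (x : 'M[K]_n) i j :
  sw_mx p q x i j = if (p <= i)%N && (j < q)%N then x i j else 0.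
Proof. by rewrite /sw_mx mul_mx_pidE mul_copid_mxE; case: leqP => _; case: ltnP. Qed.

Definition sw_rank (K : fieldType) (n p q : nat) (x : 'M[K]_n) : nat :=
  \rank (sw_mx p q x).

Lemma sw_rank_row (K : fieldType) (n p q : nat) (x : 'M[K]_n) :
  (p <= n)%N -> (sw_rank p q x <= n - p)%N.
Proof.
move=> pn; rewrite -(rank_copid_mx K pn).
exact: leq_trans (mxrankM_maxl _ _) (mxrankM_maxl _ _).
Qed.

Lemma sw_rank_col (K : fieldType) (n p q : nat) (x : 'M[K]_n) :
  (q <= n)%N -> (sw_rank p q x <= q)%N.
Proof.
move=> qn; rewrite -[leqRHS](rank_pid_mx K qn qn).
exact: mxrankM_maxr.
Qed.


Lemma sw_mx_row (K : fieldType) (n q : nat) (i : 'I_n) (x : 'M[K]_n) :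
  sw_mx i q x = sw_mx i.+1 q x + delta_mx i i *m sw_mx i q x.
Proof.
apply/matrixP => a b; rewrite [RHS]mxE [X in _ + X]mxE (bigD1 i)//= big1 => [|c ci].
  rewrite !sw_mxE mxE eqxx leqnn andbT addr0 /=.
  have [->|ai] := eqVneq a i; first by rewrite ltnn leqnn mul1r add0r.
  by rewrite mul0r addr0 (ltn_neqAle i) [_ == _ :> nat]eq_sym ai.
by rewrite !mxE (negPf ci) andbF mul0r.
Qed.

Lemma sw_mx_col (K : fieldType) (n p : nat) (j : 'I_n) (x : 'M[K]_n) :
  sw_mx p j.+1 x = sw_mx p j x + sw_mx p j.+1 x *m delta_mx j j.
Proof.
apply/matrixP => a b; rewrite [RHS]mxE [X in _ + X]mxE (bigD1 j)//= big1 => [|c cj].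
  rewrite !sw_mxE mxE eqxx ltnS leqnn addr0 /=.
  have [->|bj] := eqVneq b j; first by rewrite ltnn leqnn andbF mulr1 add0r.
  by rewrite mulr0 addr0 ?ltnS (ltn_neqAle b) bj.
by rewrite !mxE (negPf cj) mulr0.
Qed.

Lemma sw_rank_rowS (K : fieldType) (n q : nat) (i : 'I_n) (x : 'M[K]_n) :
  (sw_rank i q x <= (sw_rank i.+1 q x).+1)%N.
Proof.
rewrite /sw_rank [in leqLHS]sw_mx_row; apply: leq_trans (mxrank_add _ _) _.
by rewrite -[leqRHS]addn1 leq_add2l (leq_trans (mxrankM_maxl _ _))// mxrank_delta.
Qed.

Lemma sw_rank_colS (K : fieldType) (n p : nat) (j : 'I_n) (x : 'M[K]_n) :
  (sw_rank p j.+1 x <= (sw_rank p j x).+1)%N.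
Proof.
rewrite /sw_rank [in leqLHS]sw_mx_col; apply: leq_trans (mxrank_add _ _) _.
by rewrite -[leqRHS]addn1 leq_add2l (leq_trans (mxrankM_maxr _ _))// mxrank_delta.
Qed.

Lemma sw_mx_sub (K : fieldType) (n p q p' q' : nat) (x : 'M[K]_n) :
  (p' <= p)%N -> (q <= q')%N -> sw_mx p q x = sw_mx p q (sw_mx p' q' x).
Proof.
move=> pp qq; apply/matrixP => i j; rewrite !sw_mxE; case: andP => // -[pi jq].
by rewrite (leq_trans pp)// (leq_trans jq).
Qed.

Lemma sw_rank_sub (K : fieldType) (n p q p' q' : nat) (x : 'M[K]_n) :
  (p' <= p)%N -> (q <= q')%N -> (sw_rank p q x <= sw_rank p' q' x)%N.
Proof.
move=> pp qq; rewrite /sw_rank (sw_mx_sub x pp qq).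
exact: leq_trans (mxrankM_maxl _ _) (mxrankM_maxr _ _).
Qed.

(** Row [i] isolates the unit row vector [j], and column [j] of [A] is zero, so the row space
    becomes the direct sum of that of [A] and a line. *)
Lemma rank_add_delta (K : fieldType) (m n : nat) (A : 'M[K]_(m, n)) i j :
  (forall b, A i b = 0) -> (forall a, A a j = 0) ->
  \rank (A + delta_mx i j)%R = (\rank A).+1.
Proof.
move=> Ai Aj; set A' := (A + _)%R.
have dA : delta_mx i i *m A' = delta_mx i j.
  apply/matrixP => a b; rewrite mxE (bigD1 i)//= big1 => [|c ci].
    by rewrite !mxE Ai !eqxx andbT add0r addr0 -natrM mulnb.
  by rewrite mxE (negPf ci) andbF mul0r.
have AA : A' = A + delta_mx i j by [].
have sAA : (A <= A')%MS.
  have AE : A = (1%:M - delta_mx i i) *m A' by rewrite mulmxBl mul1mx dA AA addrK.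
  by rewrite {1}AE submxMl.
have sdA : (delta_mx i j <= A')%MS by rewrite -dA submxMl.
have A'E : (A' :=: A + delta_mx i j)%MS.
  by apply/eqmxP; rewrite addsmx_sub sAA sdA andbT AA addmx_sub_adds.
rewrite A'E mxrank_disjoint_sum ?mxrank_delta ?addn1//.
apply/eqP; rewrite -submx0; apply/rV_subP => u; rewrite sub_capmx.
move=> /andP[/submxP[c uc] /submxP[d ud]]; rewrite submx0; apply/eqP.
have ul l : l != j -> u 0 l = 0.
  by move=> lj; rewrite ud mxE big1// => a _; rewrite mxE (negPf lj) andbF mulr0.
apply/rowP => l; rewrite [RHS]mxE; have [->|/ul//] := eqVneq l j.
by rewrite uc mxE big1// => a _; rewrite Aj mulr0.
Qed.

(** * Matrix Schubert varieties *)

Lemma perm_matrix_unit (K : fieldType) (n : nat) (w : 'S_n) :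
  perm_matrix K w \in unitmx.
Proof.
have -> : perm_matrix K w = (perm_mx w)^T.
  by apply/matrixP => i j; rewrite !mxE eq_sym.
by rewrite unitmx_tr unitmx_perm.
Qed.

Lemma sw_rank_perm_full_row (K : fieldType) (n p : nat) (w : 'S_n) :
  (p <= n)%N -> sw_rank p n (perm_matrix K w) = (n - p)%N.
Proof.
move=> pn; rewrite /sw_rank /sw_mx pid_mx_1 mulmx1.
by rewrite mxrankMfree ?row_free_unit ?perm_matrix_unit// rank_copid_mx.
Qed.

Lemma sw_rank_perm_full_col (K : fieldType) (n q : nat) (w : 'S_n) :
  (q <= n)%N -> sw_rank 0 q (perm_matrix K w) = q.
Proof.
move=> qn; rewrite /sw_rank /sw_mx /copid_mx pid_mx_0 subr0 mul1mx.
by rewrite eqmxMfull ?row_full_unit ?perm_matrix_unit// rank_pid_mx.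
Qed.

(** In this and the next three lemmas, column [j] has its 1 in row [w j], so it contributes exactly
    when [p <= w j]; likewise row [i] contributes exactly when [(w^-1)%g i < q]. *)
Lemma sw_rank_perm_col_eq (K : fieldType) (n p : nat) (w : 'S_n) (j : 'I_n) :
  (w j < p)%N ->
  sw_rank p j.+1 (perm_matrix K w) = sw_rank p j (perm_matrix K w).
Proof.
move=> wjp; congr (\rank _); apply/matrixP => a b; rewrite !sw_mxE mxE.
have [->|bj] := eqVneq b j; last by rewrite ltnS (ltn_neqAle b) bj.
rewrite ltnn andbF; case: andP => // -[pa _]; case: eqP => // aw.
by move: pa; rewrite aw leqNgt wjp.
Qed.

Lemma sw_rank_perm_col_lt (K : fieldType) (n p : nat) (w : 'S_n) (j : 'I_n) :
  (p <= w j)%N ->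
  sw_rank p j.+1 (perm_matrix K w) = (sw_rank p j (perm_matrix K w)).+1.
Proof.
move=> pwj; rewrite /sw_rank -(@rank_add_delta _ _ _ _ (w j) j).
- congr (\rank _); apply/matrixP => a b; rewrite [RHS]mxE !sw_mxE !mxE.
  have [->|bj] := eqVneq b j.
    rewrite ltnSn ltnn andbT andbF add0r andbT.
    by case: eqP => [->|_]; rewrite ?pwj// if_same.
  by rewrite ltnS (ltn_neqAle b) bj andbF addr0.
- move=> b; rewrite sw_mxE mxE (inj_eq perm_inj).
  by case: andP => // -[_]; case: eqP => // ->; rewrite ltnn.
- by move=> a; rewrite sw_mxE ltnn andbF.
Qed.

Lemma sw_rank_perm_row_eq (K : fieldType) (n q : nat) (w : 'S_n) (i : 'I_n) :
  (q <= (w^-1)%g i)%N ->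
  sw_rank i q (perm_matrix K w) = sw_rank i.+1 q (perm_matrix K w).
Proof.
move=> qwi; congr (\rank _); apply/matrixP => a b; rewrite !sw_mxE mxE.
have [->|ai] := eqVneq a i; last by rewrite (ltn_neqAle i) [_ == _ :> nat]eq_sym ai.
rewrite ltnn leqnn /=; case: ltnP => // bq; case: eqP => // iw.
by move: qwi; rewrite iw permK leqNgt bq.
Qed.

Lemma sw_rank_perm_row_lt (K : fieldType) (n q : nat) (w : 'S_n) (i : 'I_n) :
  ((w^-1)%g i < q)%N ->
  sw_rank i q (perm_matrix K w) = (sw_rank i.+1 q (perm_matrix K w)).+1.
Proof.
move=> wiq; rewrite /sw_rank -(@rank_add_delta _ _ _ _ i ((w^-1)%g i)).
- congr (\rank _); apply/matrixP => a b; rewrite [RHS]mxE !sw_mxE !mxE.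
  have [->|ai] := eqVneq a i.
    rewrite ltnn leqnn /= add0r -(inj_eq (@perm_inj _ (w^-1)%g)) permK eq_sym.
    by case: eqP => [->|_]; rewrite ?wiq// if_same.
  by rewrite (ltn_neqAle i) [_ == _ :> nat]eq_sym ai addr0.
- by move=> b; rewrite sw_mxE ltnn.
- move=> a; rewrite sw_mxE mxE permKV.
  by case: andP => // -[+ _]; case: eqP => // ->; rewrite ltnn.
Qed.

(* Fulton's essential set, for the ranks of the south-west submatrices formed
   by the rows from [e.1] on and the columns before [e.2] (0-based). *)
Definition essential (n : nat) (w : 'S_n) (e : 'I_n * 'I_n) : bool :=
  [&& (0 < e.1)%N, (0 < e.2)%N, (e.1 <= w e.2)%N, (e.2 <= (w^-1)%g e.1)%N,
      [forall j : 'I_n, (j.+1 == e.2)%N ==> (w j < e.1)%N]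
    & [forall i : 'I_n, (i.+1 == e.1)%N ==> ((w^-1)%g i < e.2)%N]].

(** Off the essential set, the inequality follows from one at a neighbouring position. A step right
    or up, when taken, keeps the rank of [w] and cannot lower that of [x]; a step down or left
    lowers the rank of [w] by one and that of [x] by at most one. *)
Lemma sw_rank_essential (K : fieldType) (n : nat) (w : 'S_n) (x : 'M[K]_n) :
  (forall e, essential w e ->
     (sw_rank e.1 e.2 x <= sw_rank e.1 e.2 (perm_matrix K w))%N) ->
  forall p q, (p <= n)%N -> (q <= n)%N ->
     (sw_rank p q x <= sw_rank p q (perm_matrix K w))%N.
Proof.
move=> xw p q; set W := perm_matrix K w.
(* A lexicographic measure: each step lowers the rank of [w], or keeps it and lowers [p + (n - q)],
   which is at most 2n. *)
have [m] := ubnP (sw_rank p q W * (n + n).+1 + (p + (n - q)))%N.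
elim: m p q => // m IHm p q mu pn qn.
(* On the boundary the rank of [w] is the largest possible. *)
have [->|p0] := posnP p; first by rewrite sw_rank_perm_full_col// sw_rank_col.
have [->|q0] := posnP q; first exact: leq_trans (sw_rank_col _ _ _) _.
have [ltpn|] := ltnP p n; last first.
  move=> np; have {np}-> : p = n by apply/eqP; rewrite eqn_leq pn.
  by apply: leq_trans (sw_rank_row _ _ _) _; rewrite ?subnn.
have [ltqn|] := ltnP q n; last first.
  move=> nq; have {nq}-> : q = n by apply/eqP; rewrite eqn_leq qn.
  by rewrite sw_rank_perm_full_row// sw_rank_row.
pose P := Ordinal ltpn; pose Q := Ordinal ltqn.
have ltp1n : (p.-1 < n)%N by rewrite (leq_ltn_trans (leq_pred _)).
have ltq1n : (q.-1 < n)%N by rewrite (leq_ltn_trans (leq_pred _)).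
pose P1 := Ordinal ltp1n; pose Q1 := Ordinal ltq1n.
case: (ltnP (w Q) p) => wQ.
  have WE := sw_rank_perm_col_eq K wQ; rewrite /= in WE.
  apply: leq_trans (sw_rank_sub x (leqnn p) (leqnSn q)) _.
  rewrite -WE; apply: IHm => //; rewrite WE; move: mu.
  set z := (_ * _)%N; lia.
case: (ltnP ((w^-1)%g P) q) => wP.
  have WE := sw_rank_perm_row_lt K wP; rewrite /= in WE.
  apply: leq_trans (sw_rank_rowS q P x) _; rewrite /= WE ltnS.
  apply: IHm => //; move: mu; rewrite WE mulSn; set z := (_ * _)%N; lia.
case: (leqP p (w Q1)) => wQ1.
  have := sw_rank_perm_col_lt K wQ1; rewrite /= prednK// => WE.
  have := sw_rank_colS p Q1 x; rewrite /= prednK// WE => /leq_trans; apply.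
  rewrite ltnS; apply: IHm => //; last by rewrite ltnW.
  move: mu; rewrite WE mulSn; set z := (_ * _)%N; lia.
case: (leqP q ((w^-1)%g P1)) => wP1.
  have := sw_rank_perm_row_eq K wP1; rewrite /= prednK// => WE.
  apply: leq_trans (sw_rank_sub x (leq_pred p) (leqnn q)) _.
  rewrite -WE; apply: IHm => //; last by rewrite ltnW.
  rewrite WE; move: mu; set z := (_ * _)%N; lia.
(* No step applies, so the position is essential. *)
apply: (xw (P, Q)); rewrite /essential /= p0 q0 wQ wP /=.
apply/andP; split; apply/forallP => i; apply/implyP => /eqP iE.
  by have -> : i = Q1 by apply/val_inj; rewrite /= -iE.
by have -> : i = P1 by apply/val_inj; rewrite /= -iE.
Qed.

(** If p < p' and q' < q, the positions w^-1(p' - 1) < q' < q - 1 < w^-1(p) carry the values p' - 1,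
    w(q'), w(q - 1), p, which form the pattern 3412. *)
Lemma essential_chain (n : nat) (w : 'S_n) e e' :
  covexillary w -> essential w e -> essential w e' -> (e.1 < e'.1)%N ->
  (e.2 <= e'.2)%N.
Proof.
case: e e' => [p q] [p' q'] cw /=.
move=> /and5P[/= p0 q0 pq qp /andP[/forallP/= eq1 /forallP/= ep1]].
move=> /and5P[/= p0' q0' pq' qp' /andP[/forallP/= eq1' /forallP/= ep1']] pp.
rewrite leqNgt; apply/negP => qq; apply: cw.
have ltq1n : (q.-1 < n)%N by rewrite (leq_ltn_trans (leq_pred _)).
have ltp1n : (p'.-1 < n)%N by rewrite (leq_ltn_trans (leq_pred _)).
pose k := Ordinal ltq1n; pose i' := Ordinal ltp1n.
have wk : (w k < p)%N by have := eq1 k; rewrite /= prednK// eqxx.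
have wi : ((w^-1)%g i' < q')%N by have := ep1' i'; rewrite /= prednK// eqxx.
have qk : (q' < k)%N.
  rewrite ltn_neqAle; apply/andP; split; last by rewrite /= -ltnS prednK.
  apply/eqP => /val_inj qk; move: pq'; rewrite qk leqNgt.
  by rewrite (ltn_trans wk).
have pi : (p < i')%N.
  rewrite ltn_neqAle; apply/andP; split; last by rewrite /= -ltnS prednK.
  apply/eqP => /val_inj pE; move: qp; rewrite pE leqNgt.
  by rewrite (ltn_trans wi).
exists ((w^-1)%g i'), q', k, ((w^-1)%g p); rewrite !permKV; split; split => //.
- by rewrite (leq_trans _ qp)// /= prednK.
- by rewrite (leq_trans _ pq')// /= prednK.
Qed.

(** * Bruhat double cosets and south-west ranks *)

Lemma borel_invmx (K : fieldType) (n : nat) (b : 'M[K]_n) :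
  borel K n b -> borel K n (invmx b).
Proof.
move=> [ub bup]; split; first by rewrite unitmx_inv.
move=> i j ji; pose P : 'M[K]_n := pid_mx j.+1.
have PbP : P *m b^T *m P = P *m b^T.
  apply/matrixP => a c; rewrite mul_mx_pidE mul_pid_mxE mxE.
  by case: ltnP => // cj; case: ltnP => // ja; rewrite bup// (leq_trans ja).
(* The row span of [P] is stable under [b^T], so by rank it equals its image, and it is stable under
   the inverse. *)
have : (P <= P *m b^T)%MS.
  have sPb : (P *m b^T <= P)%MS by rewrite -PbP submxMl.
  rewrite -(mxrank_leqif_sup sPb) mxrankMfree//.
  by rewrite row_free_unit unitmx_tr.
move=> /submxP[D PD].
have PE : P *m (invmx b)^T *m P = P *m (invmx b)^T.
  rewrite trmx_inv {1 3}PD mulmxA !mulmxK ?unitmx_tr//.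
  by rewrite -mulmxA (_ : P *m P = P)// /P pid_mx_id.
have /matrixP/(_ j i) := PE.
by rewrite mul_mx_pidE ltnS leqNgt ji mul_pid_mxE ltnSn mxE => <-.
Qed.

Lemma mul_mx_perm_matrix (K : fieldType) (n : nat) (w : 'S_n) (b : 'M[K]_n) i j :
  (b *m perm_matrix K w) i j = b i (w j).
Proof.
rewrite mxE (bigD1 (w j))//= mxE eqxx mulr1 big1 ?addr0// => l lj.
by rewrite mxE (negPf lj) mulr0.
Qed.

(** Column operations by an upper triangular [C] bring [x] to the form [b *m perm_matrix K w] with
    [b] upper triangular; each column of [C] comes from a jump of the rank function. *)
Lemma sw_rank_eq_bruhat (K : fieldType) (n : nat) (w : 'S_n) (x : 'M[K]_n) :
  (forall p q, (p <= n)%N -> (q <= n)%N ->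
     sw_rank p q x = sw_rank p q (perm_matrix K w)) ->
  exists b c, [/\ borel K n b, borel K n c & x = b *m perm_matrix K w *m c].
Proof.
move=> xw.
(* [x *m c] is the vector of the flag x.E_(j+1) that lies in E_(w j + 1). *)
have /choice[c cP] (j : 'I_n) : exists c : 'cV[K]_n,
    [/\ forall i : 'I_n, (j < i)%N -> c i 0 = 0, c j 0 != 0,
        forall i : 'I_n, (w j < i)%N -> (x *m c) i 0 = 0 & (x *m c) (w j) 0 != 0].
  (* Row [w j] raises the rank of the first j + 1 columns, so some vector is killed by the block
     below this row but not by the block that includes it. *)
  have [|c [c0 c1]] :=
      @exists_ker_notin_ker _ _ _ _ (sw_mx (w j).+1 j.+1 x) (sw_mx (w j) j.+1 x).
    apply/negP => /mxrankS; rewrite -!/(sw_rank _ _ _) leqNgt => /negP; apply.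
    by rewrite !xw// ?(ltnW (ltn_ord _))// sw_rank_perm_row_lt ?permK.
  pose d : 'cV[K]_n := pid_mx j.+1 *m c; exists d.
  have xd (i : 'I_n) : (w j < i)%N -> (x *m d) i 0 = 0.
    move=> wi; have /colP/(_ i) := c0.
    by rewrite /sw_mx -!mulmxA mul_copid_mxE wi [RHS]mxE.
  split=> //.
  - by move=> i ji; rewrite mul_pid_mxE ltnS leqNgt ji.
  (* If coordinate [j] vanished, only the first [j] columns would act on [c]; there row [w j] does
     not raise the rank, so both blocks have the same row space and the same kernel. *)
  - rewrite mul_pid_mxE ltnSn; apply: contraNneq c1 => cj0.
    have sc p : sw_mx p j.+1 x *m c = sw_mx p j x *m c.
      rewrite /sw_mx -!mulmxA; congr (_ *m (_ *m _)); apply/colP => i.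
      rewrite !mul_pid_mxE ltnS leq_eqVlt.
      by case: eqP => // /val_inj ->; rewrite ltnn.
    have rE : \rank (sw_mx (w j).+1 j x) = \rank (sw_mx (w j) j x).
      rewrite -!/(sw_rank _ _ _) !xw ?(ltnW (ltn_ord _))//.
      by rewrite [RHS]sw_rank_perm_row_eq ?permK.
    have sub : (sw_mx (w j).+1 j x <= sw_mx (w j) j x)%MS.
      have -> : sw_mx (w j).+1 j x = copid_mx (w j).+1 *m sw_mx (w j) j x.
        apply/matrixP => a b; rewrite mul_copid_mxE !sw_mxE.
        by case: ltnP => // /ltnW ->.
      exact: submxMl.
    have := mxrank_leqif_sup sub; rewrite rE => -[_]; rewrite eqxx => /esym.
    move=> /submxP[D DE]; rewrite sc DE -mulmxA.
    by rewrite -(sc (w j).+1) c0 mulmx0.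
  - apply: contraNneq c1 => xdj; apply/eqP/colP => i.
    rewrite /sw_mx -!mulmxA mul_copid_mxE [RHS]mxE leq_eqVlt.
    by case: eqP => [/val_inj <-//|_]; case: ltnP => // /xd.
pose C : 'M[K]_n := \matrix_(i, j) c j i 0.
have xC i j : (x *m C) i j = (x *m c j) i 0.
  by rewrite !mxE; apply: eq_bigr => l _; rewrite mxE.
have bC : borel K n C.
  have Cup (i j : 'I_n) : (j < i)%N -> C i j = 0.
    by move=> ji; rewrite mxE; case: (cP j) => cj0 _ _ _; exact: cj0.
  split=> //; rewrite -unitmx_tr unitmxE det_trig; last first.
    by apply/is_trig_mxP => i j ij; rewrite mxE Cup.
  by rewrite unitfE; apply/prodf_neq0 => i _; rewrite !mxE; case: (cP i).
pose b : 'M[K]_n := \matrix_(i, l) (x *m C) i ((w^-1)%g l).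
have bb : borel K n b.
  have bup (i j : 'I_n) : (j < i)%N -> b i j = 0.
    move=> ji; rewrite mxE xC; case: (cP ((w^-1)%g j)) => _ _ xcj _.
    by apply: xcj; rewrite permKV.
  split=> //; rewrite -unitmx_tr unitmxE det_trig; last first.
    by apply/is_trig_mxP => i j ij; rewrite mxE bup.
  rewrite unitfE; apply/prodf_neq0 => i _; rewrite mxE mxE xC.
  by case: (cP ((w^-1)%g i)); rewrite permKV.
exists b, (invmx C); split=> //; first exact: borel_invmx.
have -> : b *m perm_matrix K w = x *m C.
  by apply/matrixP => i j; rewrite mul_mx_perm_matrix mxE permK.
by rewrite mulmxK//; case: bC.
Qed.

(** Rows of [b *m x] from [p] on involve only rows of [x] from [p] on, and similarly for columns, so
    the block of the product is a product with the block of [x]. *)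
Lemma sw_rank_bruhat_le (K : fieldType) (n p q : nat) (b x c : 'M[K]_n) :
  borel K n b -> borel K n c ->
  (sw_rank p q (b *m x *m c) <= sw_rank p q x)%N.
Proof.
move=> [_ bup] [_ cup].
have bE : copid_mx p *m b = copid_mx p *m b *m copid_mx p.
  apply/matrixP => i j; rewrite {3}/copid_mx mulmxBr mulmx1.
  rewrite [RHS]mxE [X in _ + X]mxE mul_mx_pidE mul_copid_mxE.
  case: ltnP => jp; last by rewrite subr0.
  by case: leqP => pi; rewrite ?subr0// bup ?subr0// (leq_trans jp).
have cE : c *m (pid_mx q : 'M_n) = (pid_mx q : 'M_n) *m (c *m (pid_mx q : 'M_n)).
  apply/matrixP => i j; rewrite mul_pid_mxE mul_mx_pidE.
  case: ltnP => jq; last by rewrite if_same.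
  by case: ltnP => // qi; rewrite cup// (leq_trans jq).
have -> : sw_rank p q (b *m x *m c) =
    \rank (copid_mx p *m b *m sw_mx p q x *m (c *m (pid_mx q : 'M_n))).
  congr (\rank _).
  transitivity (copid_mx p *m b *m x *m (c *m (pid_mx q : 'M_n))).
    by rewrite /sw_mx !mulmxA.
  by rewrite [in LHS]bE [in LHS]cE /sw_mx !mulmxA.
exact: leq_trans (mxrankM_maxl _ _) (mxrankM_maxr _ _).
Qed.

(** A larger rank at [x] would persist on a neighbourhood, which meets BwB. *)
Lemma matrix_schubert_sw_rank (K : fieldType) (n p q : nat) (w : 'S_n)
    (x : 'M[K]_n) :
  matrix_schubert K w x -> (sw_rank p q x <= sw_rank p q (perm_matrix K w))%N.
Proof.
move=> [_ clx]; have [F [pF Fx FN]] := rank_ge_open (sw_mx p q x).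
have [||y [Fy [b [c [bb bc yE]]]]] := clx [set N | F (sw_mx p q N) != 0].
- apply: (zariski_open_neq0 (F := F \o sw_mx p q)).
  apply: poly_fun_comp => // i j; have sA := @poly_fun_subring K n n.
  have [Ac _ _] := sA.
  apply: (fun_subring_mulmx (M := mulmx (copid_mx p)) (N := fun=> pid_mx q)) => //.
  exact: poly_fun_mulmxl.
- by [].
by apply: leq_trans (FN _ Fy) _; rewrite yE; exact: sw_rank_bruhat_le.
Qed.

(** * Affine charts of the Grassmannian *)

Lemma eq_frac_fun (K : fieldType) (m p : nat) (delta f g : 'M[K]_(m, p) -> K) :
  (forall M, delta M != 0 -> f M = g M) -> frac_fun delta f -> frac_fun delta g.
Proof.
by move=> fg [Q [d [pQ fQ]]]; exists Q, d; split=> // M dM; rewrite -fg// fQ.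
Qed.

Section Chart.
Context (K : fieldType) (n : nat) (A : 'M[K]_(n + n)).
Hypothesis uA : A \in unitmx.

Definition chart (x : 'M[K]_n) : 'M[K]_(n + n, n) := A *m col_mx 1%:M x.

(** [Col N], moved back by [A], is the graph of a matrix when this block is invertible; [chart_inv]
    is then that matrix. *)
Definition chart_top (N : 'M[K]_(n + n, n)) : 'M[K]_n := usubmx (invmx A *m N).

Definition chart_det (N : 'M[K]_(n + n, n)) : K := \det (chart_top N).

Definition chart_inv (N : 'M[K]_(n + n, n)) : 'M[K]_n :=
  dsubmx (invmx A *m N) *m invmx (chart_top N).

Lemma mx_act_graph_embedding x : mx_act A (graph_embedding x) = Col (chart x).
Proof. exact: mx_act_Col. Qed.

Lemma rank_chart x : \rank (chart x) = n.
Proof.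
rewrite eqmxMfull ?row_full_unit//; apply/eqP; rewrite eqn_leq rank_leq_col /=.
rewrite -[leqLHS](mxrank1 K n).
apply: leq_trans (mxrankM_maxr (row_mx 1%:M 0) _).
by rewrite mul_row_col mulmx1 mul0mx addr0.
Qed.

Lemma chart_topM N (g : 'M[K]_n) : chart_top (N *m g) = chart_top N *m g.
Proof. by rewrite /chart_top mulmxA mul_usub_mx. Qed.

Lemma chart_top_chart x : chart_top (chart x) = 1%:M.
Proof. by rewrite /chart_top mulKmx// col_mxKu. Qed.

Lemma chart_det_chart x : chart_det (chart x) = 1.
Proof. by rewrite /chart_det chart_top_chart det1. Qed.

Lemma chart_top_unit N : (chart_top N \in unitmx) = (chart_det N != 0).
Proof. by rewrite unitmxE unitfE. Qed.

Lemma chart_invK N : chart_det N != 0 -> chart (chart_inv N) *m chart_top N = N.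
Proof.
rewrite -chart_top_unit => uT; rewrite /chart -mulmxA mul_col_mx mul1mx.
by rewrite /chart_inv mulmxKV// vsubmxK mulKVmx.
Qed.

(** Independence of the frame lets [chart_inv] descend to the Grassmannian. *)
Lemma chart_inv_mulr N (g : 'M[K]_n) :
  g \in unitmx -> chart_det N != 0 -> chart_inv (N *m g) = chart_inv N.
Proof.
rewrite -chart_top_unit => ug uT; rewrite /chart_inv chart_topM.
apply: (canLR (mulmxK _)); first by rewrite unitmx_mul uT.
by rewrite [RHS]mulmxA mulmxKV// mul_dsub_mx mulmxA.
Qed.

Lemma chartK x : chart_inv (chart x) = x.
Proof. by rewrite /chart_inv chart_top_chart invmx1 mulmx1 mulKmx// col_mxKd. Qed.

Lemma Col_chart_inv N :
  chart_det N != 0 -> Col (chart (chart_inv N)) = Col N.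
Proof.
move=> dN; rewrite -[in RHS](chart_invK dN) Col_mulmx_unit//.
by rewrite chart_top_unit.
Qed.

Lemma rank_chart_det N : chart_det N != 0 -> \rank N = n.
Proof. by move=> dN; rewrite -dim_Col -(Col_chart_inv dN) dim_Col rank_chart. Qed.

Lemma poly_fun_chart i j : poly_fun (fun x => chart x i j).
Proof.
apply: (fun_subring_mulmx (M := fun=> A) (N := col_mx 1%:M)) => [|k l|k l].
- exact: poly_fun_subring.
- by have [Ac _ _] := @poly_fun_subring K n n.
have [Ac _ _] := @poly_fun_subring K n n.
rewrite (_ : (fun _ => _) = fun x : 'M_n =>
  match split k with inl a => (1%:M : 'M_n) a l | inr a => x a l end).
  by case: (split k) => a; [exact: Ac | exact: poly_fun_entry].
by apply/funext => x; rewrite mxE; case: split.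
Qed.

Lemma poly_fun_chart_top i j : poly_fun (fun N => chart_top N i j).
Proof.
rewrite (_ : (fun _ => _) = fun N => (invmx A *m N) (lshift n i) j).
  exact: poly_fun_mulmxl.
by apply/funext => N; rewrite [LHS]mxE.
Qed.

Lemma poly_fun_chart_det : poly_fun chart_det.
Proof.
apply: fun_subring_det => [|i j]; first exact: poly_fun_subring.
exact: poly_fun_chart_top.
Qed.

Lemma frac_fun_chart_inv i j : frac_fun chart_det (fun N => chart_inv N i j).
Proof.
have sF := frac_fun_subring poly_fun_chart_det; have [_ _ Fm] := sF.
(* On the cell the inverse of the top block is its adjugate over [chart_det]. *)
apply: (@eq_frac_fun _ _ _ _ (fun N =>
  (dsubmx (invmx A *m N) *m ((chart_det N)^-1 *: \adj (chart_top N))) i j)).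
  by move=> N dN; rewrite /chart_inv [in RHS]/invmx chart_top_unit dN.
apply: (fun_subring_mulmx (M := fun N => dsubmx (invmx A *m N))
  (N := fun N => (chart_det N)^-1 *: \adj (chart_top N)) sF) => k l.
  apply: poly_frac_fun.
  rewrite (_ : (fun _ => _) = fun N => (invmx A *m N) (rshift n k) l).
    exact: poly_fun_mulmxl.
  by apply/funext => N; rewrite [LHS]mxE.
rewrite (_ : (fun _ => _) =
    fun N => (chart_det N)^-1 * (\adj (chart_top N)) k l); last first.
  by apply/funext => N; rewrite [LHS]mxE.
apply: Fm; first exact: frac_fun_inv.
apply: fun_subring_adj => // a b; apply: poly_frac_fun.
exact: poly_fun_chart_top.
Qed.

(** The image of the chart, that is, the translate by [A] of the cell of graphs. *)
Definition chart_cell : set {vspace 'cV[K]_(n + n)} :=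
  [set V | exists2 N, chart_det N != 0 & Col N = V].

Lemma chart_cell_Col N : \rank N = n -> chart_cell (Col N) <-> chart_det N != 0.
Proof.
move=> rN; split=> [[M dM MN]|]; last by exists N.
have [g ug NM] := Col_eqP (rank_chart_det dM) MN.
rewrite -chart_top_unit NM chart_topM unitmx_mul ug andbT.
by rewrite chart_top_unit.
Qed.

Lemma chart_cell_dim : chart_cell `<=` [set V | \dim V = n].
Proof. by move=> _ [N dN <-] /=; rewrite dim_Col rank_chart_det. Qed.

Lemma frames_chart_cell (U : set {vspace 'cV[K]_(n + n)}) :
  frames n (chart_cell `&` U) = [set N | chart_det N != 0 /\ U (Col N)].
Proof.
apply/seteqP; split=> N /=; first by move=> [rN [/(chart_cell_Col rN)]].
move=> [dN UN]; have rN := rank_chart_det dN.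
by split=> //; split=> //; apply/chart_cell_Col.
Qed.

Lemma open_chart_cell : is_open (Gr K n (n + n)) chart_cell.
Proof.
split; first exact: chart_cell_dim.
rewrite -[chart_cell]setIT frames_chart_cell.
rewrite (_ : [set N | _ ] = [set N | chart_det N != 0]).
  exact/zariski_open_neq0/poly_fun_chart_det.
by apply/seteqP; split=> N //= [].
Qed.

Lemma morphism_chart :
  morphism (affine_mx K n n) (Gr K n (n + n))
    (fun x => mx_act A (graph_embedding x)).
Proof.
have [Ac _ _] := @poly_fun_subring K n n.
(* A polynomial map is a fractional map with denominator 1, so the pullback lemmas apply. *)
have f1 i j : frac_fun (fun=> 1) (fun x => chart x i j).
  by apply: poly_frac_fun; exact: poly_fun_chart.
split=> [x _|V [Vd oV]].
  by rewrite /= mx_act_graph_embedding dim_Col rank_chart.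
have VE : setT `&` (fun x => mx_act A (graph_embedding x)) @^-1` V =
    [set x | (1 : K) != 0 /\ frames n V (chart x)].
  apply/seteqP; split=> x /=; rewrite mx_act_graph_embedding oner_eq0.
    by move=> [_ Vx]; do 2!split=> //; rewrite rank_chart.
  by move=> [_ [_ Vx]].
split=> [|g rg]; rewrite /= VE; first exact: zariski_open_preimage.
have oW := zariski_open_preimage (Ac 1) f1 oV.
have rW := zariski_regular_preimage (Ac 1) f1 rg.
by apply: zariski_regularS rW => // x _; rewrite /= mx_act_graph_embedding.
Qed.

(** Each space in the cell gets an arbitrary frame, on whose choice [chart_inv] does not depend.
    Regularity is tested on frames, where the map is [chart_inv], a fraction over [chart_det]. *)
Lemma exists_chart_cell_inv : exists g : {vspace 'cV[K]_(n + n)} -> 'M[K]_n,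
  (forall N, chart_det N != 0 -> g (Col N) = chart_inv N) /\
  morphism (subspace (Gr K n (n + n)) chart_cell) (affine_mx K n n) g.
Proof.
have /choice[fr frP] (V : {vspace 'cV[K]_(n + n)}) :
    exists N : 'M[K]_(n + n, n), chart_cell V -> Col N = V /\ \rank N = n.
  (* The zero matrix is a default outside the cell. *)
  have [[N dN NV]|nV] := pselect (chart_cell V); last by exists 0.
  by exists N; rewrite rank_chart_det.
pose g V := chart_inv (fr V).
have gE N : chart_det N != 0 -> g (Col N) = chart_inv N.
  move=> dN; have [|frN rfr] := frP (Col N); first by exists N.
  rewrite /g; have [h uh ->] := Col_eqP (rank_chart_det dN) (esym frN).
  by rewrite chart_inv_mulr.
exists g; split=> //; split=> // V oV.
set W := chart_cell `&` g @^-1` V.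
have WE : frames n W = [set N | chart_det N != 0 /\ V (chart_inv N)].
  rewrite frames_chart_cell; apply/seteqP; split=> N /= [dN].
    by rewrite gE.
  by rewrite gE.
have oW : zariski_open (frames n W).
  rewrite WE; apply: zariski_open_preimage => //.
    exact: poly_fun_chart_det.
  exact: frac_fun_chart_inv.
have WO : is_open (Gr K n (n + n)) W.
  by split=> // x [/chart_cell_dim].
split=> [|h rh x [[_ Cx] Vx]].
  exists W => //; apply/seteqP; split=> x /=.
    by move=> [[_ Cx] Vx].
  by move=> [[Cx Vx] _]; do 2!split=> //; exact: chart_cell_dim.
exists W, (h \o g); split=> //.
have rW := zariski_regular_preimage poly_fun_chart_det frac_fun_chart_inv rh.
apply: zariski_regularS rW => //; rewrite WE => // N [dN _].
by rewrite /= gE.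
Qed.

End Chart.

(* The preimage of [Gr_schubert K v] under the chart is irreducible: any two of
   its points are joined by a rational curve, the image of a line joining
   adapted frames. *)
Lemma chart_Gr_schubert_irreducible (K : numFieldType) (n : nat)
    (A : 'M[K]_(n + n)) (v : 'I_n -> 'I_(n + n)) (F G : 'M[K]_n -> K) x y :
  A \in unitmx -> {homo v : i j / (i < j)%N} ->
  Gr_schubert K v (Col (chart A x)) -> Gr_schubert K v (Col (chart A y)) ->
  poly_fun F -> poly_fun G -> F x != 0 -> G y != 0 ->
  exists z, [/\ Gr_schubert K v (Col (chart A z)), F z != 0 & G z != 0].
Proof.
move=> uA vinc xv yv pF pG Fx Gy.
have pd := poly_fun_chart_det A; have fi := frac_fun_chart_inv A.
have [g ug aM] := exists_adapted (rank_chart uA x) xv.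
have [h uh aN] := exists_adapted (rank_chart uA y) yv.
(* [P] and [Q] are polynomials on frames, nonzero exactly where the frame lies in the cell and [F],
   respectively [G], is nonzero at its chart point. *)
have [P pP PE] := frac_fun_neq0 pd (frac_fun_comp pd fi pF).
have [Q pQ QE] := frac_fun_neq0 pd (frac_fun_comp pd fi pG).
have d1 z : chart_det A (chart A z) != 0 by rewrite chart_det_chart// oner_eq0.
have dg z l : l \in unitmx -> chart_det A (chart A z *m l) != 0.
  by move=> ul; rewrite -chart_top_unit chart_topM unitmx_mul ul chart_top_unit d1.
have PM : P (chart A x *m g) != 0 by rewrite PE dg//= chart_inv_mulr// chartK.
have QN : Q (chart A y *m h) != 0 by rewrite QE dg//= chart_inv_mulr// chartK.
have [t /=] := line_generic pP pQ PM QN; set L := (_ + _)%R.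
rewrite PE QE => -[/andP[dL FL] /andP[_ GL]].
exists (chart_inv A L); split=> //; rewrite Col_chart_inv//.
apply: Gr_schubert_adapted => //; first exact: rank_chart_det dL.
move=> j i vij; rewrite [LHS]mxE [X in X + _]mxE [X in _ + X]mxE.
by rewrite aM// aN// !mulr0 addr0.
Qed.

Local Close Scope classical_set_scope.

(** * The permutation tau and the sequence v *)

(** Sorting the elements by the number of sets of the chain that miss them, with ties broken by
    value, makes each set an initial segment; [tau x] is the number of predecessors of [x]. *)
Lemma exists_chain_perm (I : finType) (P : pred I) (m : nat)
    (S : I -> {set 'I_m}) :
  (forall i j, P i -> P j -> (S i \subset S j) || (S j \subset S i)) ->
  exists tau : 'S_m, forall i x, P i -> (tau x < #|S i|)%N = (x \in S i).
Proof.
move=> chain.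
pose level x := #|[set i | P i & x \notin S i]|.
have levelP i x y : P i -> x \in S i -> y \notin S i -> (level x < level y)%N.
  move=> Pi xi yi; apply/proper_card/properP; split; last first.
    by exists i; rewrite !finset.inE Pi ?xi.
  apply/fintype.subsetP => j; rewrite !finset.inE => /andP[Pj xj]; rewrite Pj /=.
  have [ij|ji] := orP (chain i j Pi Pj).
    by move: xj; rewrite (fintype.subsetP ij).
  by apply: contra yi; apply: (fintype.subsetP ji).
pose lt x y := (level x < level y)%N || (level x == level y) && (x < y)%N.
have lt_irr x : lt x x = false by rewrite /lt !ltnn andbF.
have lt_trans y x z : lt x y -> lt y z -> lt x z by rewrite /lt; lia.
have lt_total x y : x != y -> lt x y || lt y x.
  by rewrite -val_eqE /lt /=; lia.
have rank_lt x : (#|[set y | lt y x]| < m)%N.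
  rewrite -[X in (_ < X)%N]card_ord; apply/proper_card/properP.
  split; first exact: subset_predT.
  by exists x; rewrite ?finset.inE ?lt_irr.
pose f x : 'I_m := Ordinal (rank_lt x).
have f_lt x y : lt x y -> (f x < f y)%N.
  move=> xy; apply/proper_card/properP; split; last first.
    by exists x; rewrite !finset.inE ?lt_irr.
  by apply/fintype.subsetP => z; rewrite !finset.inE => /lt_trans; apply.
have f_inj : injective f.
  move=> x y fxy; apply/eqP; apply: contraT => /lt_total/orP[] /f_lt.
    by rewrite fxy ltnn.
  by rewrite fxy ltnn.
exists (perm f_inj) => i x Pi; rewrite permE /=; case: (boolP (x \in S i)) => xi.
  apply/proper_card/properP; split; last by exists x; rewrite ?finset.inE ?lt_irr.
  apply/fintype.subsetP => y; rewrite finset.inE; apply: contraTT => yi.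
  by have := levelP i x y Pi xi yi; rewrite /lt; lia.
apply/negbTE; rewrite -leqNgt; apply/subset_leq_card/fintype.subsetP => y yi.
by rewrite finset.inE /lt (levelP i).
Qed.

(** * Graphs and coordinate subspaces *)

Lemma mul_perm_matrix (K : fieldType) (m p : nat) (tau : 'S_m)
    (M : 'M[K]_(m, p)) i j :
  (perm_matrix K tau *m M) (tau i) j = M i j.
Proof.
rewrite mxE (bigD1 i)//= mxE eqxx mul1r big1 ?addr0// => l li.
by rewrite mxE (inj_eq perm_inj) eq_sym (negPf li) mul0r.
Qed.

(** Modulo the unit rows from [q] on, the rows of [copid_mx p *m x] become those of the south-west
    block, which is supported on the first [q] columns; hence the sum is direct. *)
Lemma rank_col_mx_copid (K : fieldType) (n p q : nat) (x : 'M[K]_n) :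
  (q <= n)%N ->
  \rank (col_mx (copid_mx q) (copid_mx p *m x)) = (n - q + sw_rank p q x)%N.
Proof.
move=> qn; rewrite -addsmxE -(rank_copid_mx K qn) /sw_rank.
rewrite -mxrank_disjoint_sum.
  apply/eqmx_rank/andP.
  have swE : sw_mx p q x = copid_mx p *m x - copid_mx p *m x *m copid_mx q.
    by rewrite /copid_mx -/(copid_mx p) [in RHS]mulmxBr mulmx1 opprB addrC subrK.
  have sc : (copid_mx p *m x *m copid_mx q <= (copid_mx q : 'M[K]_n))%MS.
    exact: submxMl.
  split; rewrite addsmx_sub addsmxSl /=.
    rewrite -[copid_mx p *m x](subrK (copid_mx p *m x *m copid_mx q)) -swE.
    by rewrite addrC addmx_sub_adds.
  rewrite swE addmx_sub ?addsmxSr// eqmx_opp.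
  exact: submx_trans sc (addsmxSl _ _).
apply/eqP; rewrite -submx0; apply/rV_subP => u; rewrite sub_capmx submx0.
move=> /andP[/submxP[c uc] /submxP[d ud]].
have : u *m (pid_mx q : 'M_n) = u.
  by rewrite ud /sw_mx -!mulmxA (_ : pid_mx q *m pid_mx q = pid_mx q)// pid_mx_id.
by rewrite {1}uc -mulmxA mul_copid_mx_pid// mulmx0 => <-.
Qed.

(** The left half of ['I_(n + n)] indexes the source of the graph, the right half its target. *)
Definition sw_coord (n p q : nat) : {set 'I_(n + n)} :=
  [set k | match split k with inl j => (j < q)%N | inr i => (i < p)%N end].

Lemma card_sw_coord (n p q : nat) :
  (p <= n)%N -> (q <= n)%N -> #|sw_coord n p q| = (p + q)%N.
Proof.
move=> pn qn; rewrite -sum1_card big_mkcond big_split_ord /=.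
have E r : (r <= n)%N -> (\sum_(i < n) (if (i < r)%N then 1 else 0) = r)%N.
  move=> rn; rewrite -big_mkcond -(big_ord_widen _ (fun=> 1%N) rn).
  by rewrite sum1_card card_ord.
rewrite [RHS]addnC; congr (_ + _)%N.
  rewrite -[RHS](E q)//; apply: eq_bigr => i _; rewrite finset.inE.
  by rewrite (unsplitK (inl i)).
rewrite -[RHS](E p)//; apply: eq_bigr => i _; rewrite finset.inE.
by rewrite (unsplitK (inr i)).
Qed.

(** Up to a permutation of rows, truncation leaves the rows of the identity from [q] on and those of
    [x] from [p] on. So the graph meets the coordinate subspace in dimension q - r_x(p, q). *)
Lemma rank_copid_chart (K : fieldType) (n p q : nat) (tau : 'S_(n + n))
    (x : 'M[K]_n) :
  (p <= n)%N -> (q <= n)%N ->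
  (forall k, (tau k < p + q)%N = (k \in sw_coord n p q)) ->
  \rank (copid_mx (p + q) *m chart (perm_matrix K tau) x) =
    (n - q + sw_rank p q x)%N.
Proof.
move=> pn qn tauE.
rewrite -rank_col_mx_copid// (_ : copid_mx (p + q) *m _ =
  perm_matrix K tau *m col_mx (copid_mx q) (copid_mx p *m x)).
  by rewrite eqmxMfull// row_full_unit perm_matrix_unit.
apply/matrixP => k j; rewrite -[k](permKV tau); move: (_ k) => {}k.
rewrite mul_copid_mxE leqNgt tauE !mul_perm_matrix finset.inE.
rewrite ![col_mx _ _ _ _]mxE; case: splitP => i _.
  by rewrite -leqNgt -[copid_mx q]mulmx1 mul_copid_mxE.
by rewrite -leqNgt mul_copid_mxE.
Qed.

Lemma sw_coord_subset (n p q p' q' : nat) :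
  (p <= p')%N -> (q <= q')%N -> sw_coord n p q \subset sw_coord n p' q'.
Proof.
move=> pp qq; apply/fintype.subsetP => k; rewrite !finset.inE.
by case: split => i /leq_trans; apply.
Qed.

(** Enlarging E_k to E_l lowers the rank of the truncation by at most l - k, since V + E_k lies in V
    + E_l. *)
Lemma rank_copid_leS (K : fieldType) (m p k l : nat) (M : 'M[K]_(m, p)) :
  (k <= l)%N -> (l <= m)%N ->
  (\rank (copid_mx l *m M) <= \rank (copid_mx k *m M))%N /\
  (k + \rank (copid_mx k *m M) <= l + \rank (copid_mx l *m M))%N.
Proof.
move=> kl lm.
have lk q (N : 'M[K]_(m, q)) : copid_mx l *m N = copid_mx l *m (copid_mx k *m N).
  apply/matrixP => i j; rewrite !mul_copid_mxE.
  by case: leqP => // li; rewrite (leq_trans kl li).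
split; first by rewrite lk mxrankM_maxr.
rewrite -!dim_add_flag ?(leq_trans kl)//; apply/dimvS/addvS; first exact: subvv.
by apply/subvP => u; rewrite !mem_flag_space lk => /eqP->; rewrite mulmx0.
Qed.

(* With 1-based indices, [v] is the largest sequence for which the conditions
   [dim (V :&: E_(c e + d e)) >= d e] cut out [Gr_schubert K v]:
   [v_i = min (n + i, min_(e | d e >= i) (c e + i))]. *)
Lemma exists_schubert_index (I : finType) (E : pred I) (n : nat)
    (c d : I -> nat) :
  exists v : 'I_n -> 'I_(n + n),
    [/\ {homo v : i j / (i < j)%N},
        forall (i : 'I_n) e, E e -> (i < d e)%N -> (v i <= c e + i)%N
      & forall i : 'I_n, v i = (n + i)%N :> nat \/
                  exists e, [/\ E e, (i < d e)%N & v i = (c e + i)%N :> nat]].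
Proof.
pose Q (i : 'I_n) (m : nat) :=
  (m == n + i)%N || [exists e, [&& E e, (i < d e)%N & m == (c e + i)%N]].
have exQ (i : 'I_n) : exists m, Q i m by exists (n + i)%N; rewrite /Q eqxx.
have QP (i : 'I_n) (m : nat) : reflect (m = n + i \/
    exists e, [/\ E e, i < d e & m = c e + i])%N (Q i m).
  apply: (iffP orP) => -[/eqP|].
  - by left.
  - by case/existsP => e /and3P[Ee ie /eqP]; right; exists e.
  - by left.
  - by case=> e [Ee ie /eqP me]; right; apply/existsP; exists e; rewrite Ee ie.
have minQ (i : 'I_n) : {m | Q i m & forall l, Q i l -> (m <= l)%N}.
  by exists (ex_minn (exQ i)); case: ex_minnP.
pose f i := s2val (minQ i).
have fQ (i : 'I_n) : Q i (f i) by exact: s2valP (minQ i).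
have fmin (i : 'I_n) l : Q i l -> (f i <= l)%N by exact: s2valP' (minQ i) l.
have flt (i : 'I_n) : (f i < n + n)%N.
  apply: leq_ltn_trans (fmin i (n + i)%N _) _; first by apply/QP; left.
  by rewrite ltn_add2l.
exists (fun i => Ordinal (flt i)); split=> /= [i j ij|i e Ee ie|i].
- suff : (f i < f j)%N by [].
  (* The candidate attaining the value at [j] is also one at [i], where it is smaller by j - i. *)
  have /QP[->|[e [Ee je ->]]] := fQ j.
    apply: leq_ltn_trans (fmin i (n + i)%N _) _; first by apply/QP; left.
    by rewrite ltn_add2l.
  apply: leq_ltn_trans (fmin i (c e + i)%N _) _; last by rewrite ltn_add2l.
  by apply/QP; right; exists e; rewrite (ltn_trans ij).
- by apply: fmin; apply/QP; right; exists e.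
- by have /QP := fQ i.
Qed.

Lemma exists_schubert_chart (K : fieldType) (n : nat) (w : 'S_n) :
  covexillary w ->
  exists (tau : 'S_(n + n)) (v : 'I_n -> 'I_(n + n)),
    {homo v : i j / (i < j)%N} /\
    forall x : 'M[K]_n,
      Gr_schubert K v (Col (chart (perm_matrix K tau) x)) <->
      forall e, essential w e ->
        (sw_rank e.1 e.2 x <= sw_rank e.1 e.2 (perm_matrix K w))%N.
Proof.
move=> cw; pose S (e : 'I_n * 'I_n) := sw_coord n e.1 e.2.
have [e e' Ee Ee'|tau tauP] := @exists_chain_perm _ (essential w) _ S.
  apply/orP; case: (ltngtP e.1 e'.1) => [lt|lt|eq1].
  - left; apply: sw_coord_subset; first exact: ltnW.
    exact: (essential_chain cw Ee Ee' lt).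
  - right; apply: sw_coord_subset; first exact: ltnW.
    exact: (essential_chain cw Ee' Ee lt).
  - case: (leqP e.2 e'.2) => le2; [left|right]; apply: sw_coord_subset => //.
    + by rewrite eq1.
    + by rewrite eq1.
    + exact: ltnW.
pose r (e : 'I_n * 'I_n) := sw_rank e.1 e.2 (perm_matrix K w).
have r_le e : (r e <= e.2)%N by rewrite sw_rank_col// ltnW.
(* At an essential (p, q) with rank r, V must meet E_(p + q) in dimension at least q - r; so d = q -
   r, and c = p + r makes c + d = p + q. *)
have [v [vinc vmin vatt]] := @exists_schubert_index _ (essential w) n
  (fun e => e.1 + r e)%N (fun e => e.2 - r e)%N.
exists tau, v; split=> // x.
have uA := perm_matrix_unit K tau; set N := chart _ x.
have rankN e : essential w e ->
    \rank (copid_mx (e.1 + e.2) *m N) = (n - e.2 + sw_rank e.1 e.2 x)%N.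
  move=> Ee; apply: rank_copid_chart; try exact: ltnW.
  move=> k; rewrite -(tauP e k Ee) card_sw_coord//; exact: ltnW.
apply: iff_trans (Gr_schubert_ColP v (rank_chart uA x)) _; rewrite -/N.
split=> [vN e Ee|xw i].
  have xe : (sw_rank e.1 e.2 x <= e.2)%N by rewrite sw_rank_col// ltnW.
  (* If [e.2 <= r e] the bound is automatic; otherwise the Schubert condition of index d - 1 gives
     it, since there v i + 1 <= c + d. *)
  have [re|re] := leqP e.2 (r e); first exact: leq_trans re.
  have lti : (e.2 - r e - 1 < n)%N by have := ltn_ord e.2; lia.
  have vi : (v (Ordinal lti) <= e.1 + r e + (e.2 - r e - 1))%N.
    by apply: vmin => //=; lia.
  have [||le _] := @rank_copid_leS K _ _ (v (Ordinal lti)).+1 (e.1 + e.2) N.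
  - by lia.
  - by have := ltn_ord e.1; have := ltn_ord e.2; lia.
  have := vN (Ordinal lti); rewrite /= -/(r e).
  by move: le; rewrite rankN//; have := ltn_ord e.2; lia.
have := ltn_ord (v i); have := ltn_ord i => ilt vlt.
(* If [v i = n + i], only n - i - 1 rows survive truncation, which bounds the rank. Otherwise,
   passing from E_(c + d) down to E_(c + i + 1) costs at most d - i - 1 dimensions of the
   intersection. *)
have [vi|[e [Ee ie vi]]] := vatt i.
  have := mxrankM_maxl (copid_mx (v i).+1) N.
  by rewrite rank_copid_mx//; move: (\rank _ : nat) => ?; lia.
have [||_ le] := @rank_copid_leS K _ _ (v i).+1 (e.1 + e.2) N.
- by lia.
- by have := ltn_ord e.1; have := ltn_ord e.2; lia.
have := xw e Ee; have := ltn_ord e.2; move: le ie vi; rewrite rankN// -/(r e).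
move: (\rank _ : nat) (sw_rank _ _ x) (r e) => ? ? ?.
move: (nat_of_ord (v i)) (nat_of_ord i) => ? ?.
by move: (nat_of_ord e.1) (nat_of_ord e.2) => ? ?; lia.
Qed.

(** For the converse inclusion, a neighbourhood of [x] contains the locus of some [F] with
    [F x != 0]. Irreducibility gives a point z of the preimage with [F z != 0] and ranks at least
    those of [w]; the essential conditions bound them from above, so z lies in BwB. *)
Lemma matrix_schubert_essential (K : numFieldType) (n : nat) (w : 'S_n)
    (A : 'M[K]_(n + n)) (v : 'I_n -> 'I_(n + n)) (x : 'M[K]_n) :
  A \in unitmx -> {homo v : i j / (i < j)%N} ->
  (forall y : 'M[K]_n, Gr_schubert K v (Col (chart A y)) <->
      forall e, essential w e ->
        (sw_rank e.1 e.2 y <= sw_rank e.1 e.2 (perm_matrix K w))%N) ->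
  matrix_schubert K w x <-> Gr_schubert K v (Col (chart A x)).
Proof.
move=> uA vinc vP; split=> [xw|xv].
  by apply/vP => e _; exact: matrix_schubert_sw_rank.
split=> // U /zariski_openP oU /oU[F [pF Fx FU]].
set W := perm_matrix K w.
(* The index type is ['I_n.+1] because [p] and [q] range from 0 to [n] inclusive. *)
have /choice[G GP] (pq : 'I_n.+1 * 'I_n.+1) := rank_ge_open (sw_mx pq.1 pq.2 W).
have sA := @poly_fun_subring K n n; have [Ac _ _] := sA.
have pG : poly_fun (fun y : 'M[K]_n => \prod_pq G pq (sw_mx pq.1 pq.2 y)).
  apply: fun_subring_prod => // pq; have [pGpq _ _] := GP pq.
  apply: (poly_fun_comp (phi := sw_mx pq.1 pq.2)) => // i j.
  apply: (fun_subring_mulmx (M := mulmx (copid_mx pq.1))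
    (N := fun=> pid_mx pq.2)) => //.
  exact: poly_fun_mulmxl.
have GW : \prod_pq G pq (sw_mx pq.1 pq.2 W) != 0.
  by apply/prodf_neq0 => pq _; have [] := GP pq.
have Wv : Gr_schubert K v (Col (chart A W)) by apply/vP.
have [z [/vP zv Fz /prodf_neq0 Gz]] :=
  chart_Gr_schubert_irreducible uA vinc xv Wv pF pG Fx GW.
exists z; split; first exact: FU.
apply: sw_rank_eq_bruhat => p q pn qn; apply/eqP; rewrite eqn_leq.
rewrite sw_rank_essential//=.
pose pq : 'I_n.+1 * 'I_n.+1 := (inord p, inord q).
by have [_ _] := GP pq; move=> /(_ _ (Gz pq isT)); rewrite !inordK.
Qed.

Unset Implicit Arguments.

Theorem theorem0p1 (R : realType) (n : nat) (w : 'S_n) (hw : covexillary w) :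
  exists (tau : 'S_(n + n)) (v : 'I_n -> 'I_(n + n)),
    [/\ forall i j : 'I_n, (i < j)%N -> (v i < v j)%N,
        is_schubert_variety n (n + n) (Gr_schubert R[i] v)
      & open_immersion
          (subspace (affine_mx R[i] n n) (matrix_schubert R[i] w))
          (subspace (Gr R[i] n (n + n)) (Gr_schubert R[i] v))
          (fun x : 'M[R[i]]_n =>
             mx_act (perm_matrix R[i] tau) (graph_embedding x))].
Proof.
have [tau [v [vinc vP]]] := exists_schubert_chart R[i] hw.
have uA := perm_matrix_unit R[i] tau.
exists tau, v; split=> //; first exact: Gr_schubert_variety.
have [g [gE mg]] := exists_chart_cell_inv uA.
have d1 x : chart_det (perm_matrix R[i] tau) (chart (perm_matrix R[i] tau) x) != 0.
  by rewrite chart_det_chart// oner_eq0.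
(* The chart identifies the affine space with the open cell, and the matrix Schubert variety is the
   preimage of the Schubert variety, so the isomorphism restricts. *)
apply: (@open_immersionI R[i] (affine_mx R[i] n n) (Gr R[i] n (n + n)) _ _
  (chart_cell (perm_matrix R[i] tau)) _ g).
- exact: local_Gr.
- exact: open_chart_cell.
- exact: morphism_chart.
- exact: mg.
- move=> x _; rewrite mx_act_graph_embedding.
  by exists (chart (perm_matrix R[i] tau) x).
- move=> x _; rewrite mx_act_graph_embedding.
  exact: matrix_schubert_essential.
- by move=> x _; rewrite mx_act_graph_embedding gE// chartK.
- move=> _ _ [N dN <-]; rewrite gE// mx_act_graph_embedding.
  exact: Col_chart_inv.
Qed.
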